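(* Let $\Gamma$ be a finitely generated virtually nilpotent group and let $Q$ be its unique maximal finite normal subgroup. Then for any finite generating set $S$ of $\Gamma$, the limit $\mathcal F(\Gamma,S)$ exists and $$\mathcal F(\Gamma,S)=\mathcal F(\Gamma/Q).$$
   Context: A finitely generated group is virtually nilpotent if it has a nilpotent subgroup of finite index; every such group has a unique maximal finite normal subgroup $Q$ (Dekimpe–Igodt). For a group $\Delta$ with finite generating set $T$, let $B_T(r)$ be the ball of radius $r$ about the identity in the word metric, $E_T(r)$ the set of finite-order elements in $B_T(r)$, and $\mathcal F(\Delta,T)=\lim_{r\to\infty}|E_T(r)|/|B_T(r)|$. The quotient $\Gamma/Q$ is almost crystallographic, i.e. it acts properly discontinuously and cocompactly by isometries on a connected, simply connected nilpotent Lie group $G$ with a left-invariant Riemannian metric, and can be realised as a discrete cocompact subgroup of $\mathrm{Isom}(G)$. For such groups $\mathcal F(\Gamma/Q,T)$ exists and is independent of the finite generating set $T$ (it equals $m/|F|$, where $F$ is the finite quotient of $\Gamma/Q$ by its unique maximal normal nilpotent subgroup, viewed as a group of automorphisms of the Lie algebra of $G$, and $m$ is the number of elements of $F$ not having $1$ as an eigenvalue); it is denoted $\mathcal F(\Gamma/Q)$. *)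

(* Defs.v *)
From HB Require Import structures.
From mathcomp Require Import all_boot all_order all_algebra.
From mathcomp Require Import finmap.
From mathcomp Require Import boolp classical_sets functions cardinality reals.
From mathcomp Require Import topology normedtype sequences.

Set Implicit Arguments.
Unset Strict Implicit.
Unset Printing Implicit Defensive.

Import numFieldNormedType.Exports.

Local Open Scope classical_set_scope.
Local Open Scope group_scope.

Section Subgroups.
Context {G : groupType}.
Implicit Types (A B H : set G).

Definition is_subgroup H : Prop :=
  H 1 /\ forall x y, H x -> H y -> H (x * y^-1).

Definition is_normal H : Prop := forall x y, H x -> H (x ^ y).

Definition generated A : set G :=
  \bigcap_(H in [set H | is_subgroup H /\ A `<=` H]) H.

Definition commutator_subgroup A B : set G :=
  generated [set [~ x, y] | x in A & y in B].

Fixpoint lower_central H (n : nat) : set G :=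
  if n is m.+1 then commutator_subgroup (lower_central H m) H else H.

Definition nilpotent_subgroup H : Prop :=
  is_subgroup H /\ exists n, lower_central H n = [set 1].

Definition left_coset (x : G) H : set G := [set x * h | h in H].

Definition finite_index H : Prop :=
  finite_set [set left_coset x H | x in [set: G]].

Definition finite_generating A : Prop :=
  finite_set A /\ generated A = [set: G].

(* Products of at most r letters taken from A and the inverses of A. *)
Definition word_ball A (r : nat) : set G :=
  [set x | exists w : seq G,
     [/\ (size w <= r)%N, (forall a, a \in w -> A a \/ A a^-1)
       & x = \prod_(a <- w) a]].

Definition finite_order (x : G) : Prop := exists n : nat, x ^+ n.+1 = 1.

Definition torsion_ball A (r : nat) : set G := word_ball A r `&` finite_order.

End Subgroups.

Definition finitely_generated (G : groupType) : Prop :=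
  exists A : set G, finite_generating A.

Definition virtually_nilpotent (G : groupType) : Prop :=
  exists2 H : set G, nilpotent_subgroup H & finite_index H.

Record normal_subgroup (G : groupType) := NormalSubgroup {
  normal_subgroup_set :> set G;
  normal_subgroup_is_subgroup : is_subgroup normal_subgroup_set;
  normal_subgroup_is_normal : is_normal normal_subgroup_set
}.

(* Maximal for inclusion.  As the product of two finite normal subgroups is
   again one, such a Q is unique and contains every finite normal subgroup. *)
Definition maximal_finite_normal (G : groupType) (Q : normal_subgroup G) :
    Prop :=
  finite_set Q /\
  forall H : normal_subgroup G, finite_set H -> Q `<=` H -> H `<=` Q.

Section QuotientGroup.
Variables (G : groupType) (Q : normal_subgroup G).
Local Open Scope quotient_scope.

Definition coset_rel : rel G := fun x y => `[< (Q : set G) (x * y^-1) >].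

Let Q1 : (Q : set G) 1 := (normal_subgroup_is_subgroup Q).1.
Let QB x y : (Q : set G) x -> (Q : set G) y -> (Q : set G) (x * y^-1).
Proof. exact: (normal_subgroup_is_subgroup Q).2. Qed.
Let QV x : (Q : set G) x -> (Q : set G) x^-1.
Proof. by move=> /(QB Q1); rewrite mul1g. Qed.
Let QM x y : (Q : set G) x -> (Q : set G) y -> (Q : set G) (x * y).
Proof. by move=> Qx /QV /(QB Qx); rewrite invgK. Qed.

Fact coset_rel_refl : reflexive coset_rel.
Proof. by move=> x; apply/asboolP; rewrite mulgV; exact: Q1. Qed.

Fact coset_rel_sym : symmetric coset_rel.
Proof.
by move=> x y; apply/asboolP/asboolP => /QV; rewrite invgM invgK.
Qed.

Fact coset_rel_trans : transitive coset_rel.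
Proof.
move=> y x z /asboolP Qxy /asboolP Qyz; apply/asboolP.
by have := QM Qxy Qyz; rewrite mulgA mulgVK.
Qed.

Canonical coset_equiv :=
  EquivRel coset_rel coset_rel_refl coset_rel_sym coset_rel_trans.

Definition quotient_group := {eq_quot coset_equiv}.
HB.instance Definition _ := Choice.on quotient_group.
HB.instance Definition _ := EqQuotient.on quotient_group.

Local Notation cls := (\pi_quotient_group).

Definition quotient_one : quotient_group := cls 1.
Definition quotient_mul (a b : quotient_group) : quotient_group :=
  cls (repr a * repr b).
Definition quotient_inv (a : quotient_group) : quotient_group :=
  cls (repr a)^-1.

Let quotientP (x y : G) :
  reflect (cls x = cls y) (coset_rel x y).
Proof. exact: (eqmodP coset_equiv). Qed.

Let quotientW (P : quotient_group -> Prop) :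
  (forall x : G, P (cls x)) -> forall a, P a.
Proof. exact: quotW. Qed.

Lemma pi_quotient_mul (x y : G) :
  quotient_mul (cls x) (cls y) = cls (x * y).
Proof.
apply/quotientP/asboolP.
have /quotientP/asboolP Qx : cls (repr (cls x)) = cls x.
  exact: reprK.
have /quotientP/asboolP Qy : cls (repr (cls y)) = cls y.
  exact: reprK.
set x' := repr (cls x) in Qx *.
set y' := repr (cls y) in Qy *.
have := QM (normal_subgroup_is_normal (x'^-1) Qy) Qx.
by rewrite /conjg invgK !mulgA mulgVK invgM !mulgA.
Qed.

Lemma pi_quotient_inv (x : G) : quotient_inv (cls x) = cls x^-1.
Proof.
apply/quotientP/asboolP.
have /quotientP/asboolP Qx : cls (repr (cls x)) = cls x.
  exact: reprK.
set x' := repr (cls x) in Qx *.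
have := QV (normal_subgroup_is_normal x' Qx).
by rewrite /conjg !invgM !invgK -!mulgA mulVg mulg1.
Qed.

Fact quotient_mulA : associative quotient_mul.
Proof.
do 3![elim/quotientW => ?].
by rewrite !pi_quotient_mul mulgA.
Qed.

Fact quotient_mul1 : left_id quotient_one quotient_mul.
Proof. by elim/quotientW => x; rewrite pi_quotient_mul mul1g. Qed.

Fact quotient_mulr1 : right_id quotient_one quotient_mul.
Proof. by elim/quotientW => x; rewrite pi_quotient_mul mulg1. Qed.

Fact quotient_mulV : left_inverse quotient_one quotient_inv quotient_mul.
Proof.
by elim/quotientW => x; rewrite pi_quotient_inv pi_quotient_mul mulVg.
Qed.

Fact quotient_mulrV : right_inverse quotient_one quotient_inv quotient_mul.
Proof.
by elim/quotientW => x; rewrite pi_quotient_inv pi_quotient_mul mulgV.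
Qed.

HB.instance Definition _ := isGroup.Build quotient_group
  quotient_mulA quotient_mul1 quotient_mulr1 quotient_mulV quotient_mulrV.

End QuotientGroup.

Local Open Scope ring_scope.

(* word_ball A r is finite whenever A is, so fset_set does not default to the
   empty set here. *)
Definition torsion_ratio (R : realType) (G : groupType) (A : set G) : R^nat :=
  fun r => #|` fset_set (torsion_ball A r)|%:R / #|` fset_set (word_ball A r)|%:R.

Definition has_torsion_density (R : realType) (G : groupType) (l : R) : Prop :=
  forall A : set G, finite_generating A -> torsion_ratio R A @ \oo --> l.

(* Main.v *)
(** Let K be a nilpotent normal subgroup of finite index in a group G generated
    by S, and let v n be the size of the ball of radius n.  The growth of G is
    doubling, v (2 n) <= M v n: collecting brackets of generators by weight
    covers each ball of radius k n by boundedly many translates of a ball of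
    radius L n, with L independent of k.  Doubling forces v (n + c) / v n to
    tend to 1, so all cosets of K are equidistributed in large balls.  If a
    coset E contains an element y of infinite order, then for a suitable power
    z of y the translates of the torsion of E by the powers of z are pairwise
    disjoint, so this torsion has density 0.  Hence the torsion density of G is
    the proportion of cosets of K that consist of torsion elements, whatever S.
    Adding Q to the preimage of a generating set of G / Q multiplies all balls
    and torsion balls of positive radius by |Q|, so G and G / Q have the same
    density. *)

Require Import Defs.
From mathcomp Require Import all_boot all_order all_algebra.
From mathcomp Require Import finmap zify lra ring.
From mathcomp Require Import boolp classical_sets functions cardinality reals.
From mathcomp Require Import topology normedtype sequences exp.

Set Implicit Arguments.
Unset Strict Implicit.
Unset Printing Implicit Defensive.
Import Order.TTheory GRing.Theory Num.Theory.

Local Open Scope classical_set_scope.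
Local Open Scope group_scope.

(** The delicate point is uniformity in the scale N. A bracket of weight v is charged N^-v, so a
    word of length k N costs k, and N^v letters of weight v cost 1. Rearranging words creates new
    brackets: conjugating by a letter of weight v multiplies the cost by 1 + N^-v, and the product
    of these factors over a word is at most the exponential of its cost. Constants therefore depend
    on costs only, and N drops out. The independence of L from k comes from division with remainder:
    the cost only bounds the quotients q in q N^w + r, hence the number of translates, while the
    r-part lies in a ball of radius O(N) whatever the cost. It is essential, since doubling uses the
    covering with k chosen as a multiple of L. *)

(** * Cardinalities of finite sets *)

Section Cardinal.
Context {T : choiceType}.
Implicit Types (X Y : set T).

(** [fset_set] sends an infinite set to the empty one, whence the finiteness hypotheses below. *)
Definition crd X : nat := #|` fset_set X|.

Lemma crd_le X Y : finite_set Y -> X `<=` Y -> (crd X <= crd Y)%N.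
Proof.
move=> fY sXY; have fX := sub_finite_set sXY fY.
by apply: fsubset_leq_card; rewrite -fset_set_sub.
Qed.

Lemma crd0 : crd set0 = 0%N.
Proof. by rewrite /crd fset_set0 cardfs0. Qed.

Lemma crd_gt0 X a : finite_set X -> X a -> (0 < crd X)%N.
Proof.
move=> fX Xa; rewrite /crd cardfs_gt0; apply/fset0Pn; exists a.
by rewrite in_fset_set // inE.
Qed.

Lemma crd_setU X Y : finite_set X -> finite_set Y ->
  (crd (X `|` Y) <= crd X + crd Y)%N.
Proof. by move=> fX fY; rewrite /crd fset_setU // cardfsU leq_subr. Qed.

Lemma crd_setU_disj X Y : finite_set X -> finite_set Y ->
  (forall a, X a -> Y a -> False) -> crd (X `|` Y) = (crd X + crd Y)%N.
Proof.
move=> fX fY XY; rewrite /crd fset_setU // cardfsU -fset_setI //.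
suff -> : X `&` Y = set0 by rewrite fset_set0 cardfs0 subn0.
by rewrite -subset0 => a [Xa Ya]; exact: (XY a).
Qed.

Lemma crd_setD X Y : finite_set X -> Y `<=` X ->
  crd (X `\` Y) = (crd X - crd Y)%N.
Proof.
move=> fX sYX; have fY := sub_finite_set sYX fX.
rewrite -[in RHS](setDUK sYX) crd_setU_disj ?addKn //.
  exact: finite_setD.
by move=> a Ya [].
Qed.

Lemma finite_bigcup_seq (I : eqType) (s : seq I) (F : I -> set T) :
  (forall i, i \in s -> finite_set (F i)) ->
  finite_set [set a | exists2 i, i \in s & F i a].
Proof.
move=> fF; have -> : [set a | exists2 i, i \in s & F i a] =
  \bigcup_(i in [set` s]) F i.
  by apply/seteqP; split => a [i si Fa]; exists i.
by apply: bigcup_finite => //; exact: fF.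
Qed.

Lemma crd_bigcup_seq (I : eqType) (s : seq I) (F : I -> set T) :
  (forall i, i \in s -> finite_set (F i)) ->
  (crd [set a | exists2 i, i \in s & F i a] <= \sum_(i <- s) crd (F i))%N.
Proof.
elim: s => [|i s IH] fF.
  rewrite big_nil (_ : [set a | _] = set0) ?crd0 // -subset0.
  by move=> a; case.
rewrite big_cons.
have fs j : j \in s -> finite_set (F j) by move=> js; apply: fF; rewrite inE js orbT.
have fi : finite_set (F i) by apply: fF; rewrite inE eqxx.
apply: leq_trans (leq_add (leqnn _) (IH fs)).
apply: leq_trans (crd_setU fi (finite_bigcup_seq fs)).
apply: crd_le.
  by rewrite finite_setU; split => //; exact: finite_bigcup_seq.
move=> a [j]; rewrite inE => /orP[/eqP ->|js] Fa; [by left|by right; exists j].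
Qed.

Lemma crd_bigcup_disj (I : eqType) (s : seq I) (F : I -> set T) :
  uniq s -> (forall i, i \in s -> finite_set (F i)) ->
  (forall i j a, i \in s -> j \in s -> F i a -> F j a -> i = j) ->
  crd [set a | exists2 i, i \in s & F i a] = (\sum_(i <- s) crd (F i))%N.
Proof.
elim: s => [|i s IH] /=.
  rewrite big_nil (_ : [set a | _] = set0) ?crd0 // -subset0.
  by move=> a; case.
move=> /andP[nis us] fF dF; rewrite big_cons.
have fs j : j \in s -> finite_set (F j) by move=> js; apply: fF; rewrite inE js orbT.
have fi : finite_set (F i) by apply: fF; rewrite inE eqxx.
rewrite -IH //; last first.
  by move=> j k a js ks; apply: dF; rewrite inE ?js ?ks orbT.
rewrite -crd_setU_disj //; last 2 first.
- exact: finite_bigcup_seq.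
- move=> a Fi [j js Fj]; move: nis.
  by rewrite (dF i j a _ _ Fi Fj) ?js // inE ?eqxx ?js ?orbT.
congr crd; apply/seteqP; split => a.
  by move=> [j]; rewrite inE => /orP[/eqP ->|js] Fa; [by left|by right; exists j].
move=> [Fa|[j js Fa]]; first by exists i => //; rewrite inE eqxx.
by exists j => //; rewrite inE js orbT.
Qed.

End Cardinal.

Lemma crd_image_le {T U : choiceType} (f : T -> U) (X : set T) :
  finite_set X -> (crd (f @` X) <= crd X)%N.
Proof. by move=> fX; rewrite /crd fset_set_image // leq_imfset_card. Qed.

Lemma crd_image_inj {T U : choiceType} (f : T -> U) (X : set T) :
  injective f -> finite_set X -> crd (f @` X) = crd X.
Proof. by move=> fi fX; rewrite /crd fset_set_image // card_imfset. Qed.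

(** * Word balls and subgroups *)

Section Balls.
Context {G : groupType}.
Implicit Types (A B : set G) (x y : G).

Lemma word_ball_leq A m n : (m <= n)%N -> word_ball A m `<=` word_ball A n.
Proof.
by move=> mn x [w [sw aw ->]]; exists w; split => //; exact: leq_trans mn.
Qed.

Lemma word_ball1 A n : word_ball A n 1.
Proof. by exists [::]; split => //; rewrite big_nil. Qed.

Lemma word_ball_letter A a : A a \/ A a^-1 -> word_ball A 1 a.
Proof.
move=> Aa; exists [:: a]; split => //; last by rewrite big_seq1.
by move=> b; rewrite inE => /eqP ->.
Qed.

Lemma word_ball_mul A m n x y :
  word_ball A m x -> word_ball A n y -> word_ball A (m + n) (x * y).
Proof.
move=> [w [sw aw ->]] [w' [sw' aw' ->]]; exists (w ++ w'); split.
- by rewrite size_cat leq_add.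
- by move=> a; rewrite mem_cat => /orP[/aw|/aw'].
- by rewrite big_cat.
Qed.

Lemma word_ball_inv A n x : word_ball A n x -> word_ball A n x^-1.
Proof.
move=> [w [sw aw ->]]; exists (rev [seq a^-1 | a <- w]); split.
- by rewrite size_rev size_map.
- move=> a; rewrite mem_rev => /mapP[b /aw bA ->].
  by rewrite invgK; case: bA; [right|left].
- by rewrite -map_rev big_map prodgV ?revK.
Qed.

Lemma word_ball_split A m n x : word_ball A (m + n) x ->
  exists y z, [/\ word_ball A m y, word_ball A n z & x = y * z].
Proof.
move=> [w [sw aw ->]]; exists (\prod_(a <- take m w) a), (\prod_(a <- drop m w) a).
split.
- exists (take m w); split=> //; first by rewrite size_take_min geq_minl.
  by move=> a /mem_take /aw.
- exists (drop m w); split=> //; first by rewrite size_drop leq_subLR.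
  by move=> a /mem_drop /aw.
- by rewrite -big_cat cat_take_drop.
Qed.

Lemma word_ball_exp A m k x : word_ball A m x -> word_ball A (m * k) (x ^+ k).
Proof.
move=> Bx; elim: k => [|k IH]; first exact: word_ball1.
by rewrite expgS mulnS; exact: word_ball_mul.
Qed.

Lemma word_ball0 A x : word_ball A 0 x -> x = 1.
Proof. by case=> -[|a w] [] // _ _ ->; rewrite big_nil. Qed.

Lemma word_ballS A n x : word_ball A n.+1 x ->
  x = 1 \/ exists a y, [/\ A a \/ A a^-1, word_ball A n y & x = a * y].
Proof.
case=> -[|a w] [/= sw aw ->]; first by left; rewrite big_nil.
right; exists a, (\prod_(b <- w) b); split.
- by apply: aw; rewrite inE eqxx.
- by exists w; split => // b bw; apply: aw; rewrite inE bw orbT.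
- by rewrite big_cons.
Qed.

Lemma finite_word_ball A n : finite_set A -> finite_set (word_ball A n).
Proof.
move=> fA; elim: n => [|n IH].
  by apply: (@sub_finite_set _ _ [set 1]) => // x /word_ball0.
have fA' : finite_set (A `|` [set a^-1 | a in A]).
  by rewrite finite_setU; split => //; exact: finite_image.
apply: (@sub_finite_set _ _ ([set 1] `|`
  [set a * y | a in A `|` [set a^-1 | a in A] & y in word_ball A n])).
  move=> x /word_ballS[->|[a [y [aA By ->]]]]; [by left|right].
  exists a; last by exists y.
  by case: aA => aA; [left|right; exists a^-1; rewrite ?invgK].
by rewrite finite_setU; split; [exact: finite_set1|exact: finite_image2].
Qed.

Lemma word_ball_comp A B L n : (forall a, A a -> word_ball B L a) ->
  word_ball A n `<=` word_ball B (L * n).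
Proof.
move=> AB; elim: n => [|n IH] x; first by move=> /word_ball0 ->; exact: word_ball1.
move=> /word_ballS[->|[a [y [aA /IH By ->]]]]; first exact: word_ball1.
rewrite mulnS; apply: word_ball_mul => //.
case: aA => /AB //; move/word_ball_inv; by rewrite invgK.
Qed.

Lemma is_subgroupV H x : is_subgroup H -> H x -> H (x : G)^-1.
Proof. by move=> [H1 HB] Hx; rewrite -[_^-1]mul1g; exact: HB. Qed.

Lemma is_subgroupM H x y : is_subgroup H -> H x -> H y -> H (x * y : G).
Proof.
move=> sH Hx Hy; rewrite -[y]invgK; apply: sH.2 => //; exact: is_subgroupV.
Qed.

Lemma is_subgroupX H x n : is_subgroup H -> H x -> H (x ^+ n : G).
Proof.
move=> sH Hx; elim: n => [|n IH]; first exact: sH.1.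
by rewrite expgS; exact: is_subgroupM.
Qed.

Lemma word_ball_subgroup A H n : is_subgroup H -> A `<=` H ->
  word_ball A n `<=` H.
Proof.
move=> sH AH x [w [_ aw ->]] {n}; elim: w aw => [|a w IH] aw.
  by rewrite big_nil; exact: sH.1.
rewrite big_cons; apply: is_subgroupM => //; last first.
  by apply: IH => b bw; apply: aw; rewrite inE bw orbT.
have : A a \/ A a^-1 by apply: aw; rewrite inE eqxx.
by case=> /AH // /(is_subgroupV sH); rewrite invgK.
Qed.

Lemma generated_word_ball A x : generated A = [set: G] ->
  exists n, word_ball A n x.
Proof.
move=> gA; have : generated A x by rewrite gA.
move=> /(_ [set y | exists n, word_ball A n y]); apply.
split; last by move=> a Aa; exists 1%N; apply: word_ball_letter; left.
split; first by exists 0%N; exact: word_ball1.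
move=> a b [m am] [n bn]; exists (m + n)%N.
by apply: word_ball_mul => //; exact: word_ball_inv.
Qed.

Lemma generated_word_ball_seq A (s : seq G) : generated A = [set: G] ->
  exists n, forall x, x \in s -> word_ball A n x.
Proof.
move=> gA; elim: s => [|x s [n IH]]; first by exists 0%N.
have [m Bx] := generated_word_ball x gA; exists (m + n)%N => y.
rewrite inE => /orP[/eqP ->|/IH].
  by apply: word_ball_leq Bx; exact: leq_addr.
by apply: word_ball_leq; exact: leq_addl.
Qed.

End Balls.

(** * Doubling makes the growth ratio tend to 1 *)

Section Growth.

(** Greedy choice: an element is kept unless it overlaps one already kept. It serves for overlapping
    balls and, with [ov] an equivalence, for coset representatives. *)
Lemma maximal_separated (T : eqType) (ov : T -> T -> Prop) (s : seq T) :
  (forall x, ov x x) -> (forall x y, ov x y -> ov y x) ->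
  exists t, [/\ uniq t, {subset t <= s},
    (forall x y, x \in t -> y \in t -> ov x y -> x = y) &
    forall x, x \in s -> exists2 y, y \in t & ov x y].
Proof.
move=> ovr ovs; elim: s => [|x s [t [ut ts tt st]]].
  by exists [::]; split.
have [[y yt xy]|nov] := pselect (exists2 y, y \in t & ov x y).
  exists t; split => // [z /ts zs|z]; first by rewrite inE zs orbT.
  by rewrite inE => /orP[/eqP ->|/st //]; exists y.
exists (x :: t); split.
- rewrite /= ut andbT; apply/negP => xt; apply: nov.
  by exists x.
- move=> z; rewrite !inE => /orP[->//|/ts ->]; exact: orbT.
- move=> a b; rewrite !inE => /orP[/eqP ->|aT] /orP[/eqP ->|bt] // ab.
  + by case: nov; exists b.
  + by case: nov; exists a => //; exact: ovs.
  + exact: tt.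
- move=> z; rewrite inE => /orP[/eqP ->|/st[y yt zy]].
    by exists x => //; rewrite inE eqxx.
  by exists y => //; rewrite inE yt orbT.
Qed.

Context {G : groupType}.
Variable A : set G.
Hypothesis fA : finite_set A.
Local Notation B := (word_ball A).
Local Notation v n := (crd (word_ball A n)).

Lemma growth_leq m n : (m <= n)%N -> (v m <= v n)%N.
Proof.
by move=> mn; apply: crd_le; [exact: finite_word_ball|exact: word_ball_leq].
Qed.

Lemma growth_gt0 n : (0 < v n)%N.
Proof. by apply: (@crd_gt0 _ _ 1); [exact: finite_word_ball|exact: word_ball1]. Qed.

(* Cover the annulus by balls of radius 5h around an h-separated set of points
   whose h-balls lie in the preceding annulus. *)
Lemma growth_annulus n h : (4 * h <= n)%N ->
  ((v (n + 2 * h) - v n) * v h <= (v n - v (n - 4 * h)) * v (5 * h))%N.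
Proof.
move=> hn; have fB k : finite_set (B k) by exact: finite_word_ball.
(* Such a p has length above n - 3h and at most n - h, so its h-ball lies between the radii n - 4h
   and n. *)
pose P := [set p | B (n - h) p /\ exists2 z, B (3 * h) z & ~ B n (p * z)].
have fP : finite_set P by apply: sub_finite_set (fB (n - h)%N) => p [].
pose ov (p q : G) := exists z z', [/\ B h z, B h z' & p * z = q * z'].
have [||t [ut ts tt st]] := @maximal_separated _ ov (fset_set P).
- by move=> x; exists 1, 1; split => //; exact: word_ball1.
- by move=> x y [z [z' [? ? ?]]]; exists z', z.
have inP p : (p \in fset_set P) = (p \in P) by exact: in_fset_set.
pose F k (p : G) := [set p * z | z in B k].
have fF k p : finite_set (F k p) by exact: finite_image.
have cF k p : crd (F k p) = v k by apply: crd_image_inj => //; exact: mulgI.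
have small : (size t * v h <= v n - v (n - 4 * h))%N.
  rewrite -crd_setD; [|exact: fB|by apply: word_ball_leq; exact: leq_subr].
  have -> : (size t * v h = crd [set a | exists2 p, p \in t & F h p a])%N.
    rewrite crd_bigcup_disj //.
      by rewrite (eq_bigr (fun=> v h)) => [|p _]; [rewrite big_const_seq count_predT iter_addn_0 mulnC|exact: cF].
    move=> p q a pt qt [z Bz <-] [z' Bz' /esym e].
    by apply: tt => //; exists z, z'.
  apply: crd_le; first exact: finite_setD.
  move=> a [p /ts]; rewrite inP inE => -[Bp [y By npy]] [z Bz <-]; split.
    by have := word_ball_mul Bp Bz; rewrite subnK //; lia.
  move=> Bpz; apply: npy.
  have := word_ball_mul Bpz (word_ball_mul (word_ball_inv Bz) By).
  by rewrite mulgA mulgK; apply: word_ball_leq; lia.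
have big : (v (n + 2 * h) - v n <= size t * v (5 * h))%N.
  rewrite -crd_setD; [|exact: fB|by apply: word_ball_leq; exact: leq_addr].
  have -> : (size t * v (5 * h) = \sum_(p <- t) crd (F (5 * h) p))%N.
    by rewrite (eq_bigr (fun=> v (5 * h))) => [|p _]; [rewrite big_const_seq count_predT iter_addn_0 mulnC|exact: cF].
  apply: leq_trans (crd_bigcup_seq _); last by move=> p _; exact: fF.
  apply: crd_le; first exact: finite_bigcup_seq.
  move=> x [Bx nBx].
  have [|p [z [Bp Bz xE]]] := @word_ball_split _ A (n - h) (3 * h) x.
    by apply: word_ball_leq Bx; lia.
  have /st[q qt [y [y' [By By' e]]]] : p \in fset_set P.
    by rewrite inP inE; split => //; exists z; rewrite -?xE.
  (* From x = p z and p y = q y' follows x = q (y' y^-1 z), at distance at most h + h + 3h from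
     q. *)
  exists q => //; exists (y' * y^-1 * z).
    have := word_ball_mul (word_ball_mul By' (word_ball_inv By)) Bz.
    by apply: word_ball_leq; lia.
  by rewrite !mulgA -e mulgK.
apply: leq_trans (leq_mul big (leqnn _)) _.
by rewrite mulnAC leq_mul2r small orbT.
Qed.

Definition doubling := exists M, forall n, (v (2 * n) <= M * v n)%N.

(** By the annulus estimate, tripling the thickness of an outer annulus multiplies its size by at
    least 1 + 1/K. After j triplings the factor is at least (K + j) / K, while the size never
    exceeds that of the ball; j = K J suffices. *)
Lemma growth_ratio1 : doubling -> forall J, exists n0, forall n, (n0 <= n)%N ->
  (J * (v n.+1 - v n) <= v n.+1)%N.
Proof.
move=> [M dM] J.
have dM8 h : (v (5 * h) <= M ^ 3 * v h)%N.
  apply: (@leq_trans (v (2 * (2 * (2 * h))))); first by apply: growth_leq; lia.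
  apply: leq_trans (dM _) _; rewrite !expnS -!mulnA leq_mul2l; apply/orP; right.
  apply: leq_trans (dM _) _; rewrite leq_mul2l; apply/orP; right.
  by apply: leq_trans (dM _) _; rewrite expn0 mul1n.
set K := (M ^ 3)%N in dM8.
pose g N t := (v N - v (N - t))%N.
have step N h : (6 * h <= N)%N -> (K.+1 * g N (2 * h) <= K * g N (6 * h))%N.
  move=> hN; have := @growth_annulus (N - 2 * h) h; rewrite subnK; last by lia.
  rewrite -subnDA (_ : 2 * h + 4 * h = 6 * h)%N; last by lia.
  move=> /(_ ltac:(lia)) ann.
  have ann2 : (g N (2 * h) <= K * (v (N - 2 * h) - v (N - 6 * h)))%N.
    rewrite -(leq_pmul2r (growth_gt0 h)); apply: leq_trans ann _.
    by rewrite (mulnC K) -mulnA leq_mul2l dM8 orbT.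
  have l1 : (v (N - 2 * h) <= v N)%N by apply: growth_leq; exact: leq_subr.
  have l2 : (v (N - 6 * h) <= v (N - 2 * h))%N by apply: growth_leq; lia.
  rewrite /g in ann2 *.
  have -> : (v N - v (N - 6 * h) =
    (v N - v (N - 2 * h)) + (v (N - 2 * h) - v (N - 6 * h)))%N by lia.
  by rewrite mulnDr mulSn; lia.
have K0 : (0 < K)%N.
  by have := dM8 0%N; have := growth_gt0 (5 * 0); case: (K) => //; rewrite mul0n; lia.
have iter N j : (2 * 3 ^ j <= N)%N ->
    ((K + j) * g N 2 <= K * g N (2 * 3 ^ j))%N.
  elim: j => [|j IH] jN; first by rewrite expn0 muln1 addn0.
  rewrite expnS in jN.
  have := @step N (3 ^ j)%N ltac:(lia).
  rewrite (_ : 6 * 3 ^ j = 2 * 3 ^ j.+1)%N; last by rewrite expnS; lia.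
  move=> st; have := IH ltac:(lia) => {}IH.
  rewrite -(leq_pmul2l K0); apply: (@leq_trans (K * (K.+1 * g N (2 * 3 ^ j)%N))%N).
    apply: (@leq_trans (K.+1 * ((K + j) * g N 2))%N); first by nia.
    by rewrite (mulnCA K) leq_mul2l IH orbT.
  by rewrite leq_mul2l st orbT.
exists (2 * 3 ^ (K * J))%N => n hn.
have := iter n.+1 (K * J)%N ltac:(lia); rewrite /g subn2 /= => H.
have l : (v n.-1 <= v n)%N by apply: growth_leq; lia.
rewrite -(leq_pmul2l K0); apply: (@leq_trans ((K + K * J) * (v n.+1 - v n.-1))%N).
  by rewrite mulnA leq_mul //; lia.
apply: leq_trans H _; rewrite leq_mul2l leq_subr; exact: orbT.
Qed.

(** Each of the c unit increments is at most v (n + c) / (c (J + 1)). Summing them and cancelling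
    one copy of v (n + c) - v n turns J + 1 into J and v (n + c) into v n. *)
Lemma growth_ratio c : doubling -> forall J, exists n0, forall n, (n0 <= n)%N ->
  (J * (v (n + c) - v n) <= v n)%N.
Proof.
move=> D J; case: (posnP c) => [->|c0].
  by exists 0%N => n _; rewrite addn0 subnn muln0.
have [n0 H] := growth_ratio1 D (c * J.+1); exists n0 => n hn.
have inc i : (i <= c)%N -> (c * J.+1 * (v (n + i) - v n) <= i * v (n + c))%N.
  elim: i => [|i IH] ic; first by rewrite addn0 subnn muln0.
  have := IH ltac:(lia) => {}IH.
  have := H (n + i)%N ltac:(lia); rewrite -addnS => Hi.
  have l1 : (v (n + i) <= v (n + i.+1))%N by apply: growth_leq; lia.
  have l2 : (v n <= v (n + i))%N by apply: growth_leq; lia.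
  have l3 : (v (n + i.+1) <= v (n + c))%N by apply: growth_leq; lia.
  have -> : (v (n + i.+1) - v n =
    (v (n + i.+1) - v (n + i)) + (v (n + i) - v n))%N by lia.
  by rewrite mulnDr mulSn; apply: leq_add => //; exact: leq_trans l3.
have := inc c (leqnn c); rewrite -mulnA leq_pmul2l // mulSn.
have : (v n <= v (n + c))%N by apply: growth_leq; exact: leq_addr.
lia.
Qed.

End Growth.

(** * Words in weighted brackets *)

(** The weight belongs to the derivation, not to the element: one element may be a bracket of
    several weights. *)
Inductive bracket (G : groupType) (A : set G) : nat -> G -> Prop :=
| bracket_letter a : A a \/ A a^-1 -> bracket A 1 a
| bracket_comm i j a b : bracket A i a -> bracket A j b ->
    bracket A (i + j) [~ a, b].

Section Commutators.
Context {G : groupType}.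
Implicit Types a b c : G.

Lemma commgMr c a b : [~ c, a * b] = [~ c, b] * [~ c, a] ^ b.
Proof. by rewrite /commg /conjg !gnorm. Qed.

Lemma commMgl a b c : [~ a * b, c] = [~ a, c] ^ b * [~ b, c].
Proof. by rewrite /commg /conjg !gnorm. Qed.

End Commutators.

Section Words.
Context {R : realType} {G : groupType}.
Variables (A : set G) (x : R).
Hypothesis x0 : (0 <= x)%R.
Implicit Types (W X Y : seq (nat * G)) (p : nat * G).

Lemma bracket_gt0 v b : bracket A v b -> (0 < v)%N.
Proof. by elim=> // i j _ _ _ i0 _ _; rewrite addn_gt0 i0. Qed.

Lemma bracketV v b : bracket A v b -> bracket A v b^-1.
Proof.
case=> [a Aa|i j a c Ba Bc].
  by apply: bracket_letter; rewrite invgK; case: Aa; [right|left].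
by rewrite invgR addnC; exact: bracket_comm.
Qed.

(* A letter of weight v costs x ^ v, where x is the inverse of the scale, so
   that about x^-1 ^ v letters of weight v have bounded cost. *)
Definition wcost W : R := (\sum_(p <- W) x ^+ p.1)%R.
(** The factor by which conjugating a word by the letters of [W] in turn multiplies its cost. *)
Definition wgrow W : R := (\prod_(p <- W) (1 + x ^+ p.1))%R.
Definition wval W : G := \prod_(p <- W) p.2.
Definition wtop w W : seq G := [seq p.2 | p <- W & p.1 == w].
Definition wword w W : Prop :=
  forall p, p \in W -> (w <= p.1)%N /\ bracket A p.1 p.2.

Lemma wcost_cat W W' : wcost (W ++ W') = (wcost W + wcost W')%R.
Proof. by rewrite /wcost big_cat. Qed.

Lemma wgrow_cat W W' : wgrow (W ++ W') = (wgrow W * wgrow W')%R.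
Proof. by rewrite /wgrow big_cat. Qed.

Lemma wval_cat W W' : wval (W ++ W') = wval W * wval W'.
Proof. by rewrite /wval big_cat. Qed.

Lemma wtop_cat w W W' : wtop w (W ++ W') = wtop w W ++ wtop w W'.
Proof. by rewrite /wtop filter_cat map_cat. Qed.

Lemma wcost1 p : wcost [:: p] = (x ^+ p.1)%R.
Proof. by rewrite /wcost big_seq1. Qed.

Lemma wgrow1 p : wgrow [:: p] = (1 + x ^+ p.1)%R.
Proof. by rewrite /wgrow big_seq1. Qed.

Lemma wval1 p : wval [:: p] = p.2.
Proof. by rewrite /wval big_seq1. Qed.

Lemma wword_cat w W W' : wword w (W ++ W') <-> wword w W /\ wword w W'.
Proof.
split=> [h|[h h'] p]; last by rewrite mem_cat => /orP[/h|/h'].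
by split=> p pW; apply: h; rewrite mem_cat pW ?orbT.
Qed.

Lemma wword1 w p : wword w [:: p] <-> (w <= p.1)%N /\ bracket A p.1 p.2.
Proof.
split=> [h|h q]; first by apply: h; rewrite inE.
by rewrite inE => /eqP ->.
Qed.

Lemma wword_leq w w' W : (w' <= w)%N -> wword w W -> wword w' W.
Proof. by move=> ww h p /h[wp Bp]; split => //; exact: leq_trans wp. Qed.

Lemma wtop_gt w W : wword w.+1 W -> wtop w W = [::].
Proof.
move=> h; apply/eqP; rewrite -size_eq0 size_map size_filter -leqn0 leqNgt.
by rewrite -has_count; apply/negP => /hasP[p /h[wp _] /eqP e]; rewrite e ltnn in wp.
Qed.

Lemma wcost_ge0 W : (0 <= wcost W)%R.
Proof. by apply: sumr_ge0 => p _; exact: exprn_ge0. Qed.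

Lemma wgrow_ge1 W : (1 <= wgrow W)%R.
Proof.
elim: W => [|p W IH]; first by rewrite /wgrow big_nil.
rewrite -cat1s wgrow_cat wgrow1 -[leLHS]mulr1.
by apply: ler_pM => //; rewrite lerDl; exact: exprn_ge0.
Qed.

Lemma wgrow_ge0 W : (0 <= wgrow W)%R.
Proof. by apply: le_trans (wgrow_ge1 W). Qed.

Lemma wgrow_le_exp W : (wgrow W <= expR (wcost W))%R.
Proof.
elim: W => [|p W IH]; first by rewrite /wgrow /wcost !big_nil expR0.
rewrite -cat1s wgrow_cat wcost_cat wgrow1 wcost1 expRD.
apply: ler_pM; [|exact: wgrow_ge0|exact: expR_ge1Dx|exact: IH].
by apply: addr_ge0 => //; exact: exprn_ge0.
Qed.

(** Letterwise p^b = p [p, b]: each letter is kept and followed by a heavier one. *)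
Definition conj_word v b W : seq (nat * G) :=
  flatten [seq [:: p; ((p.1 + v)%N, [~ p.2, b])] | p <- W].

Lemma conj_word_val v b W : wval (conj_word v b W) = wval W ^ b.
Proof.
elim: W => [|p W IH]; first by rewrite /wval !big_nil conj1g.
rewrite /conj_word /= -/(conj_word v b W) -cat1s -[_ :: conj_word _ _ _]cat1s.
rewrite !wval_cat !wval1 IH -[p :: W]cat1s wval_cat wval1 conjMg.
by rewrite mulgA commgEl mulVKg.
Qed.

Lemma conj_word_cost v b W :
  wcost (conj_word v b W) = ((1 + x ^+ v) * wcost W)%R.
Proof.
elim: W => [|p W IH]; first by rewrite /wcost !big_nil mulr0.
rewrite /conj_word /= -/(conj_word v b W) -cat1s -[_ :: conj_word _ _ _]cat1s.
rewrite !wcost_cat !wcost1 IH -[p :: W]cat1s wcost_cat wcost1 /= exprD.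
by ring.
Qed.

Lemma conj_word_word v b w W : bracket A v b -> wword w W ->
  wword w (conj_word v b W).
Proof.
move=> Bb h p /flattenP[s /mapP[q /h[wq Bq] ->]].
rewrite !inE => /orP[/eqP -> //|/eqP ->]; split => /=.
  by apply: leq_trans wq _; exact: leq_addr.
exact: bracket_comm.
Qed.

Lemma conj_word_top v b w W : (0 < v)%N -> wword w W ->
  wtop w (conj_word v b W) = wtop w W.
Proof.
move=> v0; elim: W => [//|p W IH] /(wword_cat w [:: p])[/wword1[wp Bp] hW].
rewrite /conj_word /= -/(conj_word v b W) -cat1s -[_ :: conj_word _ _ _]cat1s.
rewrite -[p :: W]cat1s !wtop_cat IH //; congr (_ ++ _).
by rewrite /wtop /= ifN //; lia.
Qed.

(** Induction through [c, Y p] = [c, p] [c, Y]^p. With g the growth of Y, the cost follows x^v + (1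
    + x^v) (g - 1) = (1 + x^v) g - 1. Conjugation adds only letters heavier than u + j, so the
    lightest ones are tracked exactly. *)
Lemma comm_letter_word u c j Y : bracket A u c -> (0 < j)%N -> wword j Y ->
  exists W, [/\ wword (u + j) W, wval W = [~ c, wval Y],
    perm_eq (wtop (u + j) W) [seq [~ c, b] | b <- wtop j Y] &
    (wcost W <= x ^+ u * (wgrow Y - 1))%R].
Proof.
move=> Bc j0; elim/last_ind: Y => [|Y p IH].
  exists [::]; split => //; first by rewrite /wval !big_nil commg1.
  by rewrite /wcost /wgrow !big_nil subrr mulr0.
rewrite -cats1 => /wword_cat[/IH[W [hW vW tW cW]] /wword1[jp Bp]].
case: p jp Bp => v b /= jv Bb; have v0 := bracket_gt0 Bb.
exists (((u + v)%N, [~ c, b]) :: conj_word v b W); split.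
- rewrite -cat1s; apply/wword_cat; split; last exact: conj_word_word.
  by apply/wword1; rewrite leq_add2l; split => //; exact: bracket_comm.
- rewrite -cat1s !wval_cat !wval1 conj_word_val vW /=.
  by rewrite commgMr.
- rewrite -cat1s !wtop_cat conj_word_top // map_cat perm_catC.
  apply: perm_cat tW _; rewrite /wtop /= eqn_add2l; by case: ifP.
- rewrite -cat1s wcost_cat wcost1 conj_word_cost wgrow_cat wgrow1 exprD /=.
  apply: (@le_trans _ _
    (x ^+ u * x ^+ v + (1 + x ^+ v) * (x ^+ u * (wgrow Y - 1)))%R).
    by rewrite lerD2l ler_wpM2l // addr_ge0 // exprn_ge0.
  by rewrite le_eqVlt; apply/orP; left; apply/eqP; ring.
Qed.

(** The same recursion in the first argument, through [X p, Y] = [X, Y]^p [p, Y]. *)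
Lemma comm_word_word i j X Y : (0 < i)%N -> (0 < j)%N ->
  wword i X -> wword j Y ->
  exists W, [/\ wword (i + j) W, wval W = [~ wval X, wval Y],
    perm_eq (wtop (i + j) W) [seq [~ a, b] | a <- wtop i X, b <- wtop j Y] &
    (wcost W <= (wgrow X - 1) * (wgrow Y - 1))%R].
Proof.
move=> i0 j0 + hY; elim/last_ind: X => [|X p IH].
  exists [::]; split => //; first by rewrite /wval !big_nil comm1g.
  by rewrite /wcost /wgrow !big_nil subrr mul0r.
rewrite -cats1 => /wword_cat[/IH[W [hW vW tW cW]] /wword1[ip Bp]].
case: p ip Bp => u c /= iu Bc; have u0 := bracket_gt0 Bc.
have [V [hV vV tV cV]] := comm_letter_word Bc j0 hY.
exists (conj_word u c W ++ V); split.
- apply/wword_cat; split; first exact: conj_word_word.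
  by apply: wword_leq hV; rewrite leq_add2r.
- rewrite !wval_cat wval1 conj_word_val vW vV /=.
  by rewrite commMgl.
- rewrite wtop_cat conj_word_top // wtop_cat allpairs_cat; apply: perm_cat => //.
  case: (ltngtP i u) iu => // [iu _|ui _].
    rewrite wtop_gt; last by apply: wword_leq hV; rewrite -addSn leq_add2r.
    by rewrite /wtop /= gtn_eqF.
  by rewrite -ui in tV *; rewrite /wtop /= eqxx /= cats0.
- rewrite wcost_cat conj_word_cost wgrow_cat wgrow1 /=.
  apply: (@le_trans _ _ ((1 + x ^+ u) * ((wgrow X - 1) * (wgrow Y - 1)) +
    x ^+ u * (wgrow Y - 1))%R).
    by apply: lerD => //; rewrite ler_wpM2l // addr_ge0 // exprn_ge0.
  by rewrite le_eqVlt; apply/orP; left; apply/eqP; ring.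
Qed.

End Words.

(** * Elements of bounded cost and collection of their lightest letters *)

Section Weighted.
Context {R : realType} {G : groupType}.
Variables (A : set G) (x : R).
Hypothesis x0 : (0 <= x)%R.
Implicit Types (C D : R) (g h : G).
Local Notation wcost := (wcost x).
Local Notation wgrow := (wgrow x).

Definition weighted w C g : Prop :=
  exists W, [/\ wword A w W, wval W = g & (wcost W <= C)%R].

Lemma weighted_leq w w' C C' g : (w' <= w)%N -> (C <= C')%R ->
  weighted w C g -> weighted w' C' g.
Proof.
move=> ww CC [W [hW vW cW]]; exists W; split => //; first exact: wword_leq hW.
exact: le_trans CC.
Qed.

Lemma weighted1 w C : (0 <= C)%R -> weighted w C 1.
Proof.
by move=> C0; exists [::]; split => //; rewrite /wval /wcost big_nil.
Qed.

Lemma weightedM w C D g h : weighted w C g -> weighted w D h ->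
  weighted w (C + D) (g * h).
Proof.
move=> [W [hW <- cW]] [V [hV <- cV]]; exists (W ++ V); split.
- exact/wword_cat.
- exact: wval_cat.
- by rewrite wcost_cat; exact: lerD.
Qed.

Lemma weightedV w C g : weighted w C g -> weighted w C g^-1.
Proof.
move=> [W [hW <- cW]]; exists (rev [seq (p.1, p.2^-1) | p <- W]); split.
- move=> p; rewrite mem_rev => /mapP[q /hW[wq Bq] ->]; split => //=.
  exact: bracketV.
- by rewrite /wval -map_rev big_map /= prodgV revK.
- by rewrite /wcost big_rev big_map.
Qed.

Lemma conj_word_word_grow w W Y : wword A w W -> wword A 1 Y ->
  exists W', [/\ wword A w W', wval W' = wval W ^ wval Y &
    (wcost W' <= wcost W * wgrow Y)%R].
Proof.
move=> hW; elim/last_ind: Y => [|Y p IH].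
  by exists W; split => //; rewrite /wval /wgrow !big_nil ?conjg1 ?mulr1.
rewrite -cats1 => /wword_cat[/IH[V [hV vV cV]] /wword1[_ Bp]].
exists (conj_word p.1 p.2 V); split.
- exact: conj_word_word.
- by rewrite conj_word_val vV wval_cat wval1 conjgM.
- rewrite conj_word_cost wgrow_cat wgrow1 mulrA mulrC ler_wpM2r //.
  by rewrite addr_ge0 // exprn_ge0.
Qed.

Lemma weightedJ w C D g h : weighted w C g -> weighted 1 D h ->
  weighted w (C * expR D)%R (g ^ h).
Proof.
move=> [W [hW <- cW]] [Y [hY <- cY]].
have [V [hV vV cV]] := conj_word_word_grow hW hY; exists V; split => //.
apply: (le_trans cV); apply: ler_pM => //; [exact: wcost_ge0|exact: wgrow_ge0|].
by apply: le_trans (wgrow_le_exp x0 _) _; rewrite ler_expR.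
Qed.

Lemma weightedR i j C D g h : (0 < i)%N -> (0 < j)%N ->
  weighted i C g -> weighted j D h ->
  weighted (i + j) (expR C * expR D)%R [~ g, h].
Proof.
move=> i0 j0 [W [hW <- cW]] [Y [hY <- cY]].
have [V [hV vV _ cV]] := comm_word_word x0 i0 j0 hW hY.
exists V; split => //; apply: (le_trans cV).
have bound (Z : seq (nat * G)) (E : R) : (wcost Z <= E)%R -> (0 <= wgrow Z - 1 <= expR E)%R.
  move=> cZ; rewrite subr_ge0 wgrow_ge1 // lerBlDr; apply: le_trans (wgrow_le_exp x0 _) _.
  by apply: le_trans (_ : expR E <= _)%R; rewrite ?ler_expR // lerDl.
have /andP[? ?] := bound _ _ cW; have /andP[? ?] := bound _ _ cY.
exact: ler_pM.
Qed.

Definition const_word w (s : seq G) : seq (nat * G) := [seq (w, b) | b <- s].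

Lemma const_word_val w s : wval (const_word w s) = \prod_(b <- s) b.
Proof. by rewrite /wval big_map. Qed.

Lemma const_word_cost w s : wcost (const_word w s) = ((size s)%:R * x ^+ w)%R.
Proof.
rewrite /wcost /const_word big_map /= big_const_seq count_predT iter_addr_0.
by rewrite mulr_natl.
Qed.

Lemma const_word_grow w s : wgrow (const_word w s) = ((1 + x ^+ w) ^+ size s)%R.
Proof. by rewrite /wgrow /const_word big_map /= big_const_seq count_predT iter_mulr_1. Qed.

Lemma const_word_word w s : (forall b, b \in s -> bracket A w b) ->
  wword A w (const_word w s).
Proof. by move=> hs p /mapP[b /hs Bb ->]. Qed.

Lemma const_word_top w s : wtop w (const_word w s) = s.
Proof. by elim: s => //= b s IH; rewrite /wtop /= eqxx /= -/(wtop _ _) IH. Qed.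

Lemma wtop_bracket w W b : wword A w W -> b \in wtop w W -> bracket A w b.
Proof.
by move=> h /mapP[p]; rewrite mem_filter => /andP[/eqP <-] /h[_ Bp] ->.
Qed.

Lemma wtop_cost w W : (wcost (const_word w (wtop w W)) <= wcost W)%R.
Proof.
elim: W => [|p W IH]; first by [].
rewrite -cat1s wtop_cat /const_word map_cat !wcost_cat; apply: lerD => //.
rewrite /wtop /=; case: ifP => [/eqP <-|_]; first by rewrite !wcost1.
by rewrite {1}/wcost big_nil; exact: wcost_ge0.
Qed.

Lemma wtop_grow w W : (wgrow (const_word w (wtop w W)) <= wgrow W)%R.
Proof.
elim: W => [|p W IH]; first by [].
rewrite -cat1s wtop_cat /const_word map_cat !wgrow_cat.
apply: ler_pM => //; [exact: wgrow_ge0|exact: wgrow_ge0|].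
rewrite /wtop /=; case: ifP => [/eqP <-|_]; first by rewrite !wgrow1.
by rewrite {1}/wgrow big_nil; exact: wgrow_ge1.
Qed.

(** Each heavier letter is pushed to the right past the later letters of weight [w], which keep
    their order. It gets conjugated by them, so its cost grows by at most the factor [wgrow W]. *)
Lemma collect_top w W : (0 < w)%N -> wword A w W ->
  exists t, wval W = \prod_(b <- wtop w W) b * t /\
    weighted w.+1 (wcost W * wgrow W)%R t.
Proof.
move=> w0; elim: W => [|p W IH].
  exists 1; rewrite /wval /wtop /= !big_nil mulg1; split => //.
  by apply: weighted1; apply: mulr_ge0; [exact: wcost_ge0|exact: wgrow_ge0].
rewrite -cat1s => /wword_cat[/wword1[wp Bp]] hW.
have [t [vW wt]] := IH hW.
rewrite wtop_cat wval_cat wval1 vW wcost_cat wgrow_cat wcost1 wgrow1.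
have cge := wcost_ge0 x0 W; have gge := wgrow_ge0 x0 W.
have xge : (0 <= x ^+ p.1)%R by exact: exprn_ge0.
have bnd : (wcost W * wgrow W <=
    (x ^+ p.1 + wcost W) * ((1 + x ^+ p.1) * wgrow W))%R.
  apply: ler_pM => //; first by rewrite lerDr.
  by rewrite ler_peMl // lerDl.
have -> : wtop w [:: p] = if p.1 == w then [:: p.2] else [::].
  by rewrite /wtop /=; case: ifP.
case: (p.1 =P w) => [e|ne].
  exists t; rewrite cat1s big_cons mulgA; split => //; exact: weighted_leq wt.
rewrite cat0s.
have {}wp : (w < p.1)%N by rewrite ltn_neqAle wp andbT; apply/eqP => e; exact: ne (esym e).
have h1 : wword A w.+1 [:: p] by apply/wword1.
have h2 : wword A 1 (const_word w (wtop w W)).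
  apply: (@wword_leq _ _ w); first exact: w0.
  by apply: const_word_word => b; exact: wtop_bracket.
have [V [hV vV cV]] := conj_word_word_grow h1 h2.
rewrite const_word_val wval1 in vV.
exists (wval V * t); split; first by rewrite vV [RHS]mulgA -conjgC mulgA.
have : weighted w.+1 (x ^+ p.1 * wgrow W + wcost W * wgrow W)%R (wval V * t).
  apply: weightedM => //; exists V; split => //; apply: (le_trans cV).
  by rewrite wcost1 ler_wpM2l // wtop_grow.
apply: weighted_leq => //; rewrite -mulrDl; apply: ler_wpM2l.
  exact: addr_ge0.
by rewrite ler_peMl // lerDl.
Qed.

(** The letter a comes to the front by s1 a s2 = a s1 s2 [s1, a]^s2. The correction has weight at
    least 2 w > w; its bracket costs at most x^w E and the conjugation by s2 another factor E, hence
    x^w E^2 per letter. *)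
Lemma perm_collect w s s' (E : R) : (0 < w)%N ->
  (forall b, b \in s -> bracket A w b) -> perm_eq s s' ->
  ((1 + x ^+ w) ^+ size s <= E)%R ->
  exists t, \prod_(b <- s) b = \prod_(b <- s') b * t /\
    weighted w.+1 ((size s)%:R * x ^+ w * E ^+ 2)%R t.
Proof.
move=> w0; elim: s' s => [|a s' IH] s hs ps hE.
  have -> : s = [::] by apply/perm_nilP.
  exists 1; rewrite big_nil mulg1; split => //.
  by apply: weighted1; rewrite mul0r mul0r.
have as_ : a \in s by rewrite (perm_mem ps) inE eqxx.
have xge : (0 <= x ^+ w)%R by exact: exprn_ge0.
have gpos n : (0 <= (1 + x ^+ w) ^+ n)%R by rewrite exprn_ge0 // addr_ge0.
have ex1 : (1 <= 1 + x ^+ w)%R by rewrite lerDl.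
case/splitPr: as_ hs ps hE => s1 s2 hs ps hE.
have E0 : (0 <= E)%R by exact: le_trans hE.
have sz : size (s1 ++ a :: s2) = (size (s1 ++ s2)).+1.
  by rewrite !size_cat /= addnS.
have le n : (n <= size (s1 ++ a :: s2))%N -> ((1 + x ^+ w) ^+ n <= E)%R.
  by move=> nl; apply: le_trans hE; rewrite ler_weXn2l.
have [|||t [ts wt]] := IH (s1 ++ s2).
- move=> b; rewrite mem_cat => bs; apply: hs.
  by rewrite mem_cat inE; case/orP: bs => ->; rewrite ?orbT.
- by move: ps; rewrite -[a :: s2]cat1s perm_catCA /= perm_cons.
- by apply: le; rewrite sz.
have hs1 : wword A w (const_word w s1).
  by apply: const_word_word => b bs; apply: hs; rewrite mem_cat bs.
have hs2 : wword A 1 (const_word w s2).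
  apply: (@wword_leq _ _ w) => //; apply: const_word_word => b bs.
  by apply: hs; rewrite mem_cat inE bs !orbT.
have ha : wword A w [:: (w, a)].
  by apply/wword1; split => //; apply: hs; rewrite mem_cat inE eqxx orbT.
have [V [hV vV _ cV]] := comm_word_word x0 w0 w0 hs1 ha.
have [U [hU vU cU]] := conj_word_word_grow hV hs2.
rewrite const_word_val wval1 /= in vV; rewrite const_word_val vV in vU.
exists (t * wval U); split.
  transitivity (a * (\prod_(b <- s') b * t) * wval U).
    by rewrite -ts vU !big_cat big_cons /= /commg /conjg !gnorm.
  by rewrite big_cons !mulgA.
have : weighted w.+1 ((size (s1 ++ s2))%:R * x ^+ w * E ^+ 2 +
    x ^+ w * E ^+ 2)%R (t * wval U).
  apply: weightedM => //; exists U; split => //.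
    by apply: wword_leq hU; rewrite -addn1 leq_add2l.
  apply: (le_trans cU).
  rewrite !const_word_grow wgrow1 /= addrAC subrr add0r in cV *.
  rewrite expr2 mulrA (mulrC (x ^+ w)%R E); apply: ler_pM => //; last 1 first.
  - by apply: le; rewrite size_cat /= addnS ltnW // ltnS leq_addl.
  - exact: wcost_ge0.
  apply: (le_trans cV); rewrite ler_wpM2r // lerBlDr.
  by rewrite (le_trans (le _ _)) // ?lerDl // size_cat leq_addr.
apply: weighted_leq => //; rewrite sz -[in leRHS]addn1 natrD !mulrDl mul1r.
exact: lexx.
Qed.

(** The first term pays for pushing out the heavier letters, the second for permuting those of
    weight [w]. *)
Definition collect_bound (C : R) : R := (C * expR C + C * expR C ^+ 2)%R.

Lemma weighted_collect w W s C : (0 < w)%N -> wword A w W -> (wcost W <= C)%R ->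
  perm_eq (wtop w W) s ->
  exists t, wval W = \prod_(b <- s) b * t /\ weighted w.+1 (collect_bound C) t.
Proof.
move=> w0 hW cW ps; have [t [vW wt]] := collect_top w0 hW.
have C0 : (0 <= C)%R by apply: le_trans cW; exact: wcost_ge0.
have gC : (wgrow W <= expR C)%R.
  by apply: le_trans (wgrow_le_exp x0 _) _; rewrite ler_expR.
have gs : ((1 + x ^+ w) ^+ size (wtop w W) <= expR C)%R.
  by rewrite -const_word_grow; apply: le_trans gC; exact: wtop_grow.
have [u [eu wu]] := perm_collect w0 (fun b => wtop_bracket hW) ps gs.
exists (u * t); split; first by rewrite vW eu mulgA.
rewrite /collect_bound addrC; apply: weightedM.
  apply: weighted_leq wu => //; rewrite -const_word_cost.
  rewrite ler_wpM2r ?exprn_ge0 ?expR_ge0 //; apply: le_trans cW.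
  exact: wtop_cost.
apply: weighted_leq wt => //; apply: ler_pM => //; [exact: wcost_ge0|exact: wgrow_ge0].
Qed.

End Weighted.

(** * Distortion and covering *)

Section Distortion.
Context {R : realType} {G : groupType}.
Variable A : set G.
Local Notation scale N := (N%:R^-1 : R)%R.
Local Notation wtd N := (weighted A (scale N)).

Let scale_ge0 N : (0 <= scale N)%R.
Proof. by rewrite invr_ge0 ler0n. Qed.

Lemma word_ball_weighted N k y : (0 < N)%N -> word_ball A (k * N) y ->
  wtd N 1 k%:R y.
Proof.
move=> N0 [s [ss sA ->]]; exists (const_word 1 s); split.
- by apply: const_word_word => b /sA; exact: bracket_letter.
- exact: const_word_val.
- rewrite const_word_cost expr1 ler_pdivrMr ?ltr0n // -natrM ler_nat.
  exact: ss.
Qed.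

Lemma power_word_cost N i p (a : G) : (0 < N)%N -> (p <= N ^ i)%N ->
  (wcost (scale N) (const_word i (nseq p a)) <= 1)%R.
Proof.
move=> N0 pN; rewrite const_word_cost size_nseq exprVn ler_pdivrMr.
  by rewrite mul1r -natrX ler_nat.
by rewrite exprn_gt0 // ltr0n.
Qed.

Lemma power_word_val i p (a : G) : wval (const_word i (nseq p a)) = a ^+ p.
Proof. by rewrite const_word_val big_nseq iter_mulg_1. Qed.

Lemma power_word_word i p (a : G) : bracket A i a ->
  wword A i (const_word i (nseq p a)).
Proof. by move=> Ba; apply: const_word_word => b /nseqP[->]. Qed.

Lemma weighted_power N i p (a : G) : (0 < N)%N -> bracket A i a ->
  (p <= N ^ i)%N -> wtd N i 1%R (a ^+ p).
Proof.
move=> N0 Ba pN; exists (const_word i (nseq p a)).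
by split; [exact: power_word_word|exact: power_word_val|exact: power_word_cost].
Qed.

Lemma allpairs_nseq (f : G -> G -> G) p q a b :
  [seq f c d | c <- nseq p a, d <- nseq q b] = nseq (p * q) (f a b).
Proof.
elim: p => [//|p IH].
by rewrite /= IH map_nseq -nseqD mulSn.
Qed.

(** The lightest letters of the commutator word are p q copies of [a, b]. Both powers cost at most
    1, so the bound on the rest is free of N. *)
Lemma comm_power N i j p q (a b : G) : (0 < N)%N ->
  bracket A i a -> bracket A j b -> (p <= N ^ i)%N -> (q <= N ^ j)%N ->
  exists t, [~ a ^+ p, b ^+ q] = [~ a, b] ^+ (p * q) * t /\
    wtd N (i + j).+1 (collect_bound (expR 1 * expR 1)) t.
Proof.
move=> N0 Ba Bb pN qN; have i0 := bracket_gt0 Ba; have j0 := bracket_gt0 Bb.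
have [W [hW vW tW cW]] := comm_word_word (scale_ge0 N) i0 j0
  (power_word_word (p := p) Ba) (power_word_word (p := q) Bb).
rewrite !power_word_val in vW; rewrite !const_word_top allpairs_nseq in tW.
have bound k n (c : G) : (n <= N ^ k)%N ->
    (0 <= wgrow (scale N) (const_word k (nseq n c)) - 1 <= expR 1)%R.
  move=> nN; rewrite subr_ge0 wgrow_ge1 // lerBlDr.
  apply: (@le_trans _ _ (expR 1)); last by rewrite lerDl.
  apply: le_trans (wgrow_le_exp _ _) _ => //; rewrite ler_expR.
  exact: power_word_cost.
have cW' : (wcost (scale N) W <= expR 1 * expR 1)%R.
  apply: (le_trans cW); have /andP[? ?] := bound i p a pN.
  by have /andP[? ?] := bound j q b qN; exact: ler_pM.
have [|t [tE wt]] := weighted_collect (scale_ge0 N) _ hW cW' tW.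
  by rewrite addn_gt0 i0.
by exists t; rewrite -vW tE big_nseq iter_mulg_1.
Qed.

(** An estimate modulo heavier letters; [L] and [C] are the quantities to be kept independent of
    [N]. *)
Definition reached L C N w (g : G) := exists y t,
  [/\ word_ball A (L * N) y, wtd N w.+1 C t & g = y * t].

Lemma reached_leq L L' (C C' : R) N w g : (L <= L')%N -> (C <= C')%R ->
  reached L C N w g -> reached L' C' N w g.
Proof.
move=> LL CC [y [t [By wt gE]]]; exists y, t; split => //.
  by apply: word_ball_leq By; rewrite leq_mul2r LL orbT.
exact: weighted_leq wt.
Qed.

Lemma reachedM L L' (C C' : R) N w g g' : (0 < N)%N ->
  reached L C N w g -> reached L' C' N w g' ->
  reached (L + L') (C * expR L'%:R + C')%R N w (g * g').
Proof.
move=> N0 [y [t [By wt ->]]] [y' [t' [By' wt' ->]]].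
exists (y * y'), (t ^ y' * t'); split.
- by rewrite mulnDl; exact: word_ball_mul.
- apply: weightedM => //; apply: weightedJ => //; exact: word_ball_weighted.
- by rewrite /conjg !gnorm.
Qed.

(* Writing a^p = y1 t1 and b^q = y2 t2 gives [a, b]^(p q) = [y1, y2] up to
   letters of weight above i + j. *)
Lemma comm_reached (L : nat) (C : R) : exists (L' : nat) (C' : R),
  forall N i j p q (a b : G), (0 < N)%N ->
  bracket A i a -> bracket A j b -> (p <= N ^ i)%N -> (q <= N ^ j)%N ->
  reached L C N i (a ^+ p) -> reached L C N j (b ^+ q) ->
  reached L' C' N (i + j) ([~ a, b] ^+ (p * q)).
Proof.
(* The commutator of two elements of length L N has length at most 4 L N; the cost is read off from
   the factors found below. *)
exists (L + (L + (L + L)))%N; eexists => N i j p q a b N0 Ba Bb pN qN.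
move=> [y1 [t1 [By1 wt1 e1]]] [y2 [t2 [By2 wt2 e2]]].
have i0 := bracket_gt0 Ba; have j0 := bracket_gt0 Bb.
have [t [cE wt]] := comm_power N0 Ba Bb pN qN.
(* Being short only gives y1 weight 1, but y1 = a^p t1^-1 shows it as a word of weight at least i
   and bounded cost. This puts [y1, t2] above weight i + j. *)
have wy1 : wtd N i (1 + C)%R y1.
  have -> : y1 = a ^+ p * t1^-1 by rewrite e1 mulgK.
  apply: weightedM; first exact: weighted_power.
  by apply: weightedV; apply: weighted_leq wt1.
have wy2 : wtd N j (1 + C)%R y2.
  have -> : y2 = b ^+ q * t2^-1 by rewrite e2 mulgK.
  apply: weightedM; first exact: weighted_power.
  by apply: weightedV; apply: weighted_leq wt2.
have wz := weightedR (scale_ge0 N) i0 j0 wy1 wy2.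
set z := [~ y1, y2] in wz.
have wz1 : wtd N 1 (expR (1 + C) * expR (1 + C))%R z.
  by apply: weighted_leq wz; rewrite // addn_gt0 i0.
have w12 := weightedR (scale_ge0 N) i0 (ltn0Sn j) wy1 wt2.
have w21 := weightedR (scale_ge0 N) (ltn0Sn i) j0 wt1 (weighted_power N0 Bb qN).
rewrite addnS in w12; rewrite addSn in w21.
have w1t1 : wtd N 1 C t1 by apply: weighted_leq wt1.
have w1t2 : wtd N 1 C t2 by apply: weighted_leq wt2.
have wt21 : wtd N 2 (C + C)%R (t2 * t1).
  by apply: weightedM; [apply: weighted_leq wt2|apply: weighted_leq wt1].
have wzt := weightedR (scale_ge0 N) _ _ wz wt21.
have {}wzt : wtd N (i + j).+1 (expR (expR (1 + C) * expR (1 + C)) * expR (C + C))%R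
    [~ z, t2 * t1].
  apply: weighted_leq (wzt _ _) => //; first by rewrite addn2.
  by rewrite addn_gt0 i0.
(* Expansion of [y1 t1, b^q] and of [y1, y2 t2], with the main term z = [y1, y2] moved to the front;
   all other factors are heavier than i + j. *)
exists z, (([~ y1, t2] ^ t1) ^ z * [~ z, t2 * t1] * [~ t1, b ^+ q] * t^-1).
split.
- rewrite !mulnDl /z /commg /conjg; apply: word_ball_mul; first exact: word_ball_inv.
  by apply: word_ball_mul; [exact: word_ball_inv|exact: word_ball_mul].
- apply: weightedM; last exact: weightedV wt.
  apply: weightedM w21; apply: weightedM wzt.
  exact: (weightedJ (scale_ge0 N) (weightedJ (scale_ge0 N) w12 w1t1) wz1).
- have -> : [~ a, b] ^+ (p * q) = [~ a ^+ p, b ^+ q] * t^-1.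
    by rewrite cE mulgK.
  rewrite [in LHS]e1 commMgl {1}e2 commgMr -/z.
  by rewrite /conjg /commg /conjg !gnorm.
Qed.

(** Induction on the weight. For a bracket [a, b] with weights i and j, write e = q N^i + r with q
    <= N^j: the two parts come from the commutators of a^(N^i) with b^q and of a^r with b. *)
Lemma distortion w : exists (L : nat) (C : R), forall N v b e, (0 < N)%N ->
  (v <= w)%N -> bracket A v b -> (e <= N ^ v)%N -> reached L C N v (b ^+ e).
Proof.
elim: w => [|w [L [C IH]]].
  exists 0%N, 0%R => N v b e _ + /bracket_gt0; lia.
have [L' [C' H]] := comm_reached L C.
set C2 := (C' * expR L'%:R + C')%R.
(* The summands serve the lighter brackets, the letters (a^e has length at most N) and the two
   commutators. *)
exists (L + (1 + (L' + L')))%N, (Num.max C (Num.max 0%R C2)) => N v b e N0 vw Bb.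
have [vw' eN|wv] := leqP v w.
  apply: reached_leq (IH _ _ _ _ N0 vw' Bb eN); first exact: leq_addr.
  by rewrite le_max lexx.
case: Bb vw wv => {v b} [a Aa|i j a b Ba Bb] vw wv eN.
  apply: (@reached_leq 1 _ 0%R); first lia.
    by rewrite !le_max lexx !orbT.
  exists (a ^+ e), 1; split; last by rewrite mulg1.
    apply: (@word_ball_leq _ _ (1 * e)); first by rewrite !mul1n -[N]expn1.
    by apply: word_ball_exp; exact: word_ball_letter.
  exact: weighted1.
have i0 := bracket_gt0 Ba; have j0 := bracket_gt0 Bb.
apply: (@reached_leq (L' + L') _ C2); first lia.
  by rewrite !le_max lexx !orbT.
have Ni0 : (0 < N ^ i)%N by rewrite expn_gt0 N0.
have r1 p : (p <= N ^ i)%N -> reached L C N i (a ^+ p).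
  by apply: IH => //; lia.
have r2 q : (q <= N ^ j)%N -> reached L C N j (b ^+ q).
  by apply: IH => //; lia.
rewrite (divn_eq e (N ^ i)) expgnDr; apply: reachedM => //.
  rewrite mulnC; have qN : (e %/ N ^ i <= N ^ j)%N.
    by rewrite -(leq_pmul2l Ni0) -expnD; apply: leq_trans eN; rewrite mulnC leq_trunc_div.
  by apply: H => //; [exact: r1|exact: r2].
have rN : (e %% N ^ i <= N ^ i)%N by rewrite ltnW // ltn_mod.
rewrite -[(e %% N ^ i)%N]muln1; apply: H => //; last 2 first.
- exact: r1.
- by apply: r2; rewrite expn_gt0 N0.
- by rewrite expn_gt0 N0.
Qed.

Lemma finite_bracket v : finite_set A -> finite_set (bracket A v).
Proof.
move=> fA; elim/ltn_ind: v => v IH.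
pose F i := [set [~ a, b] | a in bracket A i & b in bracket A (v - i)%N].
apply: (@sub_finite_set _ _ (word_ball A 1 `|`
    [set b | exists2 i, i \in iota 1 v.-1 & F i b])).
  move=> b Bb; case: Bb {IH} @F => {v b} [a Aa|i j c d Bc Bd] F.
    by left; exact: word_ball_letter.
  right; have i0 := bracket_gt0 Bc; have j0 := bracket_gt0 Bd.
  exists i; first by rewrite mem_iota; lia.
  by exists c => //; exists d => //; rewrite addKn.
rewrite finite_setU; split; first exact: finite_word_ball.
apply: finite_bigcup_seq => i; rewrite mem_iota => iv.
by apply: finite_image2; apply: IH; lia.
Qed.

Lemma reached_prod (L : nat) (C : R) n : exists C' : R,
  forall N w (s : seq G) (f : G -> G), (0 < N)%N -> size s = n ->
  (forall b, b \in s -> reached L C N w (f b)) ->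
  reached (n * L) C' N w (\prod_(b <- s) f b).
Proof.
elim: n => [|n [C' IH]].
  exists 0%R => N w [|//] f N0 _ _; exists 1, 1; split.
  - exact: word_ball1.
  - exact: weighted1.
  - by rewrite big_nil mulg1.
exists (C * expR (n * L)%:R + C')%R => N w [//|b s] f N0 [sn] rs.
rewrite big_cons mulSn; apply: reachedM => //.
  by apply: rs; rewrite inE eqxx.
by apply: IH => // c cs; apply: rs; rewrite inE cs orbT.
Qed.

(** The count is (k + 1)^(size s), whatever [m], so that [m] may later be N^w. *)
Lemma power_blocks (s : seq G) (k : nat) : exists M : nat, forall m,
  exists U : seq G, (size U <= M)%N /\
    forall q : G -> nat, (forall b, (q b <= k)%N) ->
      \prod_(b <- s) b ^+ (q b * m) \in U.
Proof.
elim: s => [|b s [M IH]].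
  by exists 1%N => m; exists [:: 1]; split => // q _; rewrite big_nil inE.
exists (k.+1 * M)%N => m; have [U [sU HU]] := IH m.
exists [seq b ^+ (i * m) * u | i <- iota 0 k.+1, u <- U]; split.
  by rewrite size_allpairs size_iota leq_mul2l sU orbT.
move=> q qk; rewrite big_cons; apply/allpairsP.
exists (q b, \prod_(c <- s) c ^+ (q c * m)).
by split; [rewrite mem_iota add0n ltnS; exact: qk|exact: HU|].
Qed.

Lemma prod_flatten_nseq (s : seq G) (f : G -> nat) :
  \prod_(b <- flatten [seq nseq (f b) b | b <- s]) b = \prod_(b <- s) b ^+ f b.
Proof.
rewrite big_flatten big_map; apply: eq_bigr => b _.
by rewrite big_nseq iter_mulg_1.
Qed.

Lemma perm_flatten_nseq (s t : seq G) : uniq s -> {subset t <= s} ->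
  perm_eq t (flatten [seq nseq (count_mem b t) b | b <- s]).
Proof.
move=> us ts; apply/allP => a _ /=; apply/eqP.
have -> f : count_mem a (flatten [seq nseq (f b) b | b <- s]) =
    if a \in s then f a else 0%N.
  elim: s us {ts} => [//|b s IH] /= /andP[bs us].
  rewrite count_cat count_nseq IH //= inE eq_sym; case: eqP => [->|_] /=.
    by rewrite (negPf bs) mul1n addn0.
  by rewrite mul0n.
case: ifPn => // /negP nas; apply/eqP; rewrite -leqn0 leqNgt -has_count.
by apply/negP => /hasP[b /ts bs /= /eqP e]; apply: nas; rewrite -e.
Qed.

Lemma perm_flatten_nseqD (s : seq G) (f h : G -> nat) :
  perm_eq (flatten [seq nseq (f b + h b) b | b <- s])
    (flatten [seq nseq (f b) b | b <- s] ++ flatten [seq nseq (h b) b | b <- s]).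
Proof.
elim: s => [//|b s IH] /=; rewrite nseqD -!catA perm_cat2l.
by rewrite perm_sym perm_catCA perm_cat2l perm_sym.
Qed.

(* Collect the letters of weight w: each occurs q N^w + r times with q bounded,
   which leaves boundedly many prefixes, while the r-th power with r < N^w lies
   in a ball of radius O(N) up to heavier letters. *)
Lemma weighted_cover c : finite_set A ->
  (forall v b, (c <= v)%N -> bracket A v b -> b = 1) ->
  forall d w, (c <= w + d)%N -> (0 < w)%N ->
  exists L : nat, forall C : R, exists M : nat, forall N, (0 < N)%N ->
  exists F : seq G, (size F <= M)%N /\ forall g, wtd N w C g ->
    exists u z, [/\ u \in F, word_ball A (L * N) z & g = u * z].
Proof.
move=> fA cA; elim=> [|d IH] w cw w0.
  exists 0%N => C; exists 1%N => N N0; exists [:: 1]; split => // g [W [hW <- _]].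
  exists 1, 1; split; [by rewrite inE|exact: word_ball1|].
  rewrite mulg1 /wval big1_seq // => p /andP[_ /hW[wp Bp]].
  by apply: (cA p.1) => //; rewrite addn0 in cw; exact: leq_trans wp.
have [L' IHL] := IH w.+1 ltac:(lia) isT.
have [L0 [C0 dist]] := distortion w.
have [s [us sE]] : exists s : seq G, uniq s /\ forall b, bracket A w b <-> b \in s.
  exists (fset_set (bracket A w)); split; first exact: fset_uniq.
  by move=> b; rewrite in_fset_set ?inE //; exact: finite_bracket.
have [C1 rprod] := reached_prod L0 C0 (size s).
exists (L' + size s * L0)%N => C.
have [k Ck] : exists k : nat, (C <= k%:R)%R.
  exists (Num.bound (Num.norm C)).
  exact: ltW (le_lt_trans (ler_norm C) (archi_boundP (normr_ge0 C))).
have [MU HU] := power_blocks s k.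
(* The remainder will be conjugated by an element of length at most (size s) L0 N, hence the
   exponential. *)
have [M' HM'] := IHL ((C1 + collect_bound C) * expR (size s * L0)%:R)%R.
exists (MU * M')%N => N N0.
have [U [sU UP]] := HU (N ^ w)%N; have [F [sF FP]] := HM' N N0.
exists [seq u * u' | u <- U, u' <- F]; split; first by rewrite size_allpairs leq_mul.
move=> g [W [hW <- cW]].
set tp := wtop w W; pose m := (N ^ w)%N.
have m0 : (0 < m)%N by rewrite expn_gt0 N0.
have szt : (size tp <= k * m)%N.
  have : (wcost (scale N) (const_word w tp) <= k%:R)%R.
    by apply: le_trans (wtop_cost _ _ _) _ => //; exact: le_trans Ck.
  rewrite const_word_cost exprVn ler_pdivrMr ?exprn_gt0 ?ltr0n //.
  by rewrite -natrX -natrM ler_nat.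
pose q b := (count_mem b tp %/ m)%N; pose r b := (count_mem b tp %% m)%N.
have pt : perm_eq tp (flatten [seq nseq (q b * m) b | b <- s] ++
                      flatten [seq nseq (r b) b | b <- s]).
  have ts : {subset tp <= s} by move=> b /(wtop_bracket hW) /sE.
  apply: perm_trans (perm_flatten_nseq us ts) _.
  apply: perm_trans (perm_flatten_nseqD _ _ _).
  by apply/permP => P; under eq_map => b do rewrite {1}(divn_eq (count_mem b tp) m).
have [t [gE wt]] := weighted_collect (scale_ge0 N) w0 hW cW pt.
rewrite big_cat !prod_flatten_nseq /= in gE.
have uU : \prod_(b <- s) b ^+ (q b * m) \in U.
  apply: UP => b; rewrite -(leq_pmul2r m0); apply: leq_trans (leq_trunc_div _ _) _.
  exact: leq_trans (count_size _ _) szt.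
have [y [t1 [By wt1 yE]]] : reached (size s * L0) C1 N w (\prod_(b <- s) b ^+ r b).
  apply: rprod => // b bs.
  by apply: dist => //; [exact/sE|rewrite ltnW // ltn_mod].
have Wy := word_ball_weighted N0 (word_ball_inv By).
have [u' [z [u'F Bz tE]]] :=
  FP _ (weightedJ (scale_ge0 N) (weightedM wt1 wt) Wy).
exists (\prod_(b <- s) b ^+ (q b * m) * u'), (z * y); split.
- by apply/allpairsP; exists (\prod_(b <- s) b ^+ (q b * m), u').
- by rewrite mulnDl; exact: word_ball_mul.
(* The short factor y moves to the right end, so that the boundedly many prefixes meet on the
   left. *)
- transitivity (\prod_(b <- s) b ^+ (q b * m) * (t1 * t) ^ y^-1 * y).
    by rewrite gE yE /conjg !gnorm.
  by rewrite tE !mulgA.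
Qed.

End Distortion.

(** * Doubling for virtually nilpotent groups *)

Section LowerCentral.
Context {G : groupType}.
Implicit Types (A B H K : set G).

Lemma generated_is_subgroup A : is_subgroup (generated A).
Proof.
split=> [H [sH _]|x y gx gy H HA]; first exact: sH.1.
by apply: HA.1.2; [exact: gx|exact: gy].
Qed.

Lemma sub_generated A : A `<=` generated A.
Proof. by move=> a Aa H [_ AH]; exact: AH. Qed.

Lemma generated_subP A H : is_subgroup H -> A `<=` H -> generated A `<=` H.
Proof. by move=> sH AH x /(_ H); apply. Qed.

Lemma lower_central_is_subgroup K n :
  is_subgroup K -> is_subgroup (lower_central K n).
Proof. by case: n => // n _; exact: generated_is_subgroup. Qed.

Lemma lower_central_comm K n x y :
  lower_central K n x -> K y -> lower_central K n.+1 [~ x, y].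
Proof. by move=> Kx Ky; apply: sub_generated; exists x => //; exists y. Qed.

Lemma lower_central_sub K H n : K `<=` H -> lower_central K n `<=` lower_central H n.
Proof.
move=> KH; elim: n => [//|n IH] /=.
apply: generated_subP; first exact: generated_is_subgroup.
by move=> _ [x Kx [y Ky <-]]; apply: lower_central_comm; [exact: IH|exact: KH].
Qed.

Lemma lower_central_normal K n : is_normal K -> is_normal (lower_central K n).
Proof.
move=> nK; elim: n => [//|n IH] x g Lx.
apply: (Lx [set u | lower_central K n.+1 (u ^ g)]); split.
  have sL : is_subgroup (lower_central K n.+1) by exact: generated_is_subgroup.
  split=> /= [|u v Lu Lv]; first by rewrite conj1g; exact: sL.1.
  by rewrite conjMg conjVg; exact: sL.2.
move=> _ [u Ku [v Kv <-]] /=; rewrite conjRg.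
by apply: lower_central_comm; [exact: IH|exact: nK].
Qed.

(* A bracket of weight at least 2 ^ h has nesting depth at least h. *)
Lemma bracket_lower_central A K h v b : is_subgroup K -> A `<=` K ->
  bracket A v b -> (2 ^ h <= v)%N -> lower_central K h b.
Proof.
move=> sK AK Bb; have KV x : K x -> K x^-1 by exact: is_subgroupV.
have BK w c : bracket A w c -> K c.
  elim=> [a [/AK //|/AK /KV]|i j a d _ Ka _ Kd]; first by rewrite invgK.
  by rewrite /commg /conjg; do ![apply: is_subgroupM => //]; exact: KV.
elim: Bb h => [a Aa|i j a d Ba IHa Bd IHd] [|h] hv; try exact: BK.
- by apply: (BK 1%N); exact: bracket_letter.
- by move: hv; rewrite expnS; have := expn_gt0 2 h; lia.
- by apply: (BK (i + j)%N); exact: bracket_comm.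
have [ih|jh] : (2 ^ h <= i \/ 2 ^ h <= j)%N by move: hv; rewrite expnS; lia.
  by apply: lower_central_comm; [exact: IHa|exact: BK Bd].
rewrite -invgR; apply: (is_subgroupV (lower_central_is_subgroup h.+1 sK)).
by apply: lower_central_comm; [exact: IHd|exact: BK Ba].
Qed.

Lemma nilpotent_ball_cover (R : realType) A K n : finite_set A ->
  is_subgroup K -> A `<=` K -> lower_central K n = [set 1] ->
  exists L : nat, forall k : nat, exists M : nat, forall N, (0 < N)%N ->
  exists F : seq G, (size F <= M)%N /\
    forall g, word_ball A (k * N) g ->
      exists u z, [/\ u \in F, word_ball A (L * N) z & g = u * z].
Proof.
move=> fA sK AK Kn.
have tr v b : (2 ^ n <= v)%N -> bracket A v b -> b = 1.
  by move=> nv Bb; have := bracket_lower_central sK AK Bb nv; rewrite Kn.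
have [L HL] := @weighted_cover R G A (2 ^ n)%N fA tr (2 ^ n)%N 1%N (leq_addl _ _) isT.
exists L => k; have [M HM] := HL k%:R%R; exists M => N N0.
have [F [sF FP]] := HM N N0; exists F; split => // g Bg; apply: FP.
exact: word_ball_weighted.
Qed.

(** Schreier rewriting with the letters u s t^-1 lying in K. A word is read from the left, its
    current coset representative being carried along; 1 is adjoined as the initial one. The length
    does not grow. *)
Lemma schreier (S K : set G) (ts : seq G) : finite_set S -> is_subgroup K ->
  (forall x, exists2 t, t \in ts & K (x * t^-1)) ->
  exists A, [/\ finite_set A, A `<=` K & forall n x, word_ball S n x ->
    exists y t, [/\ word_ball A n y, t \in 1 :: ts & x = y * t]].
Proof.
move=> fS sK tsP; pose us := 1 :: ts.
pose A := [set a | K a /\ exists2 p, p \in [seq (u, t) | u <- us, t <- us] &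
  [set p.1 * s * p.2^-1 | s in word_ball S 1] a].
exists A; split.
- apply: sub_finite_set (@finite_bigcup_seq _ _
    [seq (u, t) | u <- us, t <- us]
    (fun p => [set p.1 * s * p.2^-1 | s in word_ball S 1]) _).
    by move=> a [].
  by move=> p _; apply: finite_image; exact: finite_word_ball.
- by move=> a [].
elim=> [|n IH] x.
  move=> /word_ball0 ->; exists 1, 1; rewrite mulg1; split => //.
    exact: word_ball1.
  by rewrite inE eqxx.
rewrite -addn1 => /word_ball_split[x' [s [/IH[y [u [By uus ->]]] Bs ->]]].
have [t tts Kt] := tsP (u * s).
exists (y * (u * s * t^-1)), t; split.
- apply: word_ball_mul => //; apply: word_ball_letter; left; split => //.
  exists (u, t); last by exists s.
  by apply/allpairsP; exists (u, t); split => //; rewrite inE tts orbT.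
- by rewrite inE tts orbT.
- by rewrite !mulgA mulgVK.
Qed.

Lemma virtually_nilpotent_doubling (R : realType) (S K : set G) (ts : seq G) n :
  finite_generating S -> is_subgroup K -> lower_central K n = [set 1] ->
  (forall x, exists2 t, t \in ts & K (x * t^-1)) -> doubling S.
Proof.
move=> [fS gS] sK Kn tsP.
have [A [fA AK SA]] := schreier fS sK tsP.
have [L HL] := nilpotent_ball_cover R fA sK AK Kn.
have [c Ac] : exists c, forall a, A a -> word_ball S c a.
  have [c Hc] := generated_word_ball_seq (fset_set A) gS; exists c => a Aa.
  by apply: Hc; rewrite in_fset_set // inE.
(* The multiple 4 L' may depend on L because the covering fixes L before k. *)
pose L' := (c * L).+1; have [M HM] := HL (4 * L')%N.
pose us := 1 :: ts.
(* The second summand handles the radii below L', for which N would be 0. *)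
exists (M * size us + crd (word_ball S (2 * L')))%N => m.
have fB k : finite_set (word_ball S k) by exact: finite_word_ball.
have [mL|Lm] := ltnP m L'.
  apply: (@leq_trans (crd (word_ball S (2 * L')))).
    by apply: growth_leq => //; lia.
  by rewrite mulnDl (leq_trans _ (leq_addl _ _)) // leq_pmulr // growth_gt0.
rewrite mulnDl (leq_trans _ (leq_addr _ _)) //.
(* As N is positive, m < L' (N + 1) <= 2 L' N, so the radius 2 m is covered, while the covering
   balls have radius c L N <= m. *)
pose N := (m %/ L')%N; have N0 : (0 < N)%N by rewrite divn_gt0.
have [F [sF FP]] := HM N N0.
have m1 : (2 * m <= 4 * L' * N)%N.
  have := divn_eq m L'; have := ltn_pmod m (ltn0Sn (c * L)).
  by rewrite -/L' -/N; nia.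
have m2 : (c * (L * N) <= m)%N.
  apply: (@leq_trans (N * L')); last exact: leq_trunc_div.
  by rewrite /L'; nia.
pose T (p : G * G) := [set p.1 * z * p.2 | z in word_ball S m].
have fT p : finite_set (T p) by exact: finite_image.
apply: (@leq_trans (\sum_(p <- [seq (u, t) | u <- F, t <- us]) crd (T p))).
  apply: leq_trans (crd_bigcup_seq _); last by move=> p _.
  apply: crd_le; first by apply: finite_bigcup_seq => p _.
  move=> x /(word_ball_leq m1) /SA[y [t [/FP[u [z [uF Bz ->]]] tus ->]]].
  exists (u, t); first by apply/allpairsP; exists (u, t).
  exists z => //; apply: word_ball_leq m2 _ _; exact: word_ball_comp Bz.
apply: (@leq_trans (\sum_(p <- [seq (u, t) | u <- F, t <- us]) crd (word_ball S m))).
  by apply: leq_sum => p _; apply: crd_image_le.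
rewrite big_const_seq count_predT iter_addn_0 size_allpairs mulnC leq_mul2r.
by rewrite leq_mul2r sF !orbT.
Qed.

End LowerCentral.

Lemma finite_range_section (T : choiceType) (U : eqType) (f : T -> U) :
  finite_set [set f x | x in [set: T]] ->
  exists s : seq T, forall x, exists2 y, y \in s & f y = f x.
Proof.
move=> /finite_seqP[us fus].
suff [s Hs] : exists s : seq T, forall x, f x \in us -> exists2 y, y \in s & f y = f x.
  exists s => x; apply: Hs; have : [set f x | x in [set: T]] (f x) by exists x.
  by rewrite fus.
elim: us {fus} => [|u us [s Hs]]; first by exists [::].
have [[y fy]|nf] := pselect (exists y, f y = u).
  exists (y :: s) => x; rewrite inE => /orP[/eqP ->|/Hs[z zs fz]].
    by exists y => //; rewrite inE eqxx.
  by exists z => //; rewrite inE zs orbT.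
exists s => x; rewrite inE => /orP[/eqP fx|/Hs //].
by case: nf; exists x.
Qed.

(** * Normal core of a finite-index subgroup and transversals *)

Section NormalCore.
Context {G : groupType}.
Implicit Types (H K : set G).

Definition normal_core H : set G := [set x | forall g, H (x ^ g)].

Lemma normal_core_sub H : normal_core H `<=` H.
Proof. by move=> x /(_ 1); rewrite conjg1. Qed.

Lemma normal_core_is_subgroup H : is_subgroup H -> is_subgroup (normal_core H).
Proof.
move=> sH; split=> [g|x y hx hy g]; first by rewrite conj1g; exact: sH.1.
by rewrite conjMg conjVg; exact: sH.2.
Qed.

Lemma normal_core_normal H : is_normal (normal_core H).
Proof. by move=> x y hx g; rewrite -conjgM. Qed.

Lemma finite_index_cover H : is_subgroup H -> finite_index H ->
  exists s : seq G, forall x, exists2 g, g \in s & H (g^-1 * x).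
Proof.
move=> sH /finite_range_section[s Hs]; exists s => x.
have [g gs e] := Hs x; exists g => //.
have : left_coset x H x by exists 1; rewrite ?mulg1 //; exact: sH.1.
by rewrite -e => -[h Hh <-]; rewrite mulKg.
Qed.

Lemma normal_core_cover H : is_subgroup H -> finite_index H ->
  exists s : seq G, forall x, exists2 g, g \in s & normal_core H (g^-1 * x).
Proof.
move=> sH /(finite_index_cover sH)[s Hs].
pose c y := find (fun g => `[< H (g^-1 * y) >]) s.
have cP y : H ((nth 1 s (c y))^-1 * y).
  have : has (fun g => `[< H (g^-1 * y) >]) s.
    by apply/hasP; have [g gs Hg] := Hs y; exists g => //; exact/asboolP.
  by move=> /(nth_find 1) /asboolP.
(* The class of x modulo the core is determined by the permutation that x
   induces on the left cosets of H. *)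
pose f (x : G) : {ffun 'I_(size s) -> 'I_(size s).+1} :=
  [ffun i : 'I_(size s) => inord (c (x * nth 1 s i))].
have [t Ht] := finite_range_section (finite_finset : finite_set [set f x | x in [set: G]]).
exists t => x; have [g gt /ffunP fE] := Ht x; exists g => // h.
have [i iE] : exists i : 'I_(size s), H ((nth 1 s i)^-1 * h).
  have [k ks Hk] := Hs h; have ik : (index k s < size s)%N by rewrite index_mem.
  by exists (Ordinal ik); rewrite /= nth_index.
have := fE i; rewrite !ffunE => /(congr1 val); rewrite /= !inordK ?ltnS ?find_size //.
set gi := nth 1 s i in iE * => ce.
have H1 := cP (g * gi); have H2 := cP (x * gi); rewrite ce in H1.
have H3 : H ((g * gi)^-1 * (x * gi)).
  have := is_subgroupM sH (is_subgroupV sH H1) H2.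
  by rewrite !gnorm.
(* Since gi^-1 h lies in H, conjugation by h differs from conjugation by gi only by an element of
   H. *)
have := is_subgroupM sH (is_subgroupV sH iE) (is_subgroupM sH H3 iE).
by rewrite /conjg !gnorm.
Qed.

Lemma transversal_exists K (s : seq G) : is_subgroup K ->
  (forall x, exists2 g, g \in s & K (g^-1 * x)) ->
  exists ts : seq G, [/\ uniq ts,
    (forall x, exists2 t, t \in ts & K (t^-1 * x)) &
    forall t t', t \in ts -> t' \in ts -> K (t^-1 * t') -> t = t'].
Proof.
move=> sK sP.
have [||ts [uts _ dts cts]] := @maximal_separated G (fun x y => K (x^-1 * y)) s.
- by move=> x; rewrite mulVg; exact: sK.1.
- by move=> x y /(is_subgroupV sK); rewrite !gnorm.
exists ts; split => // x; have [g gs Kg] := sP x; have [t tts Kt] := cts g gs.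
exists t => //; have := is_subgroupM sK (is_subgroupV sK Kt) Kg.
by rewrite !gnorm.
Qed.

End NormalCore.

(** * Torsion in the cosets of a nilpotent normal subgroup *)

Section QuotientMap.
Variables (G : groupType) (N : normal_subgroup G).
Local Open Scope quotient_scope.

Definition quotient_map (x : G) : quotient_group N := \pi x.

Lemma quotient_mapM x y : quotient_map (x * y) = quotient_map x * quotient_map y.
Proof. by rewrite /quotient_map -pi_quotient_mul. Qed.

Lemma quotient_map1 : quotient_map 1 = 1.
Proof. by []. Qed.

Lemma quotient_mapV x : quotient_map x^-1 = (quotient_map x)^-1.
Proof. by rewrite /quotient_map -pi_quotient_inv. Qed.

Lemma quotient_mapX x n : quotient_map (x ^+ n) = quotient_map x ^+ n.
Proof. by elim: n => [//|n IH]; rewrite !expgS quotient_mapM IH. Qed.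

Lemma quotient_mapP x y : quotient_map x = quotient_map y <-> (N : set G) (x * y^-1).
Proof.
split=> [/(eqmodP (coset_equiv N)) /asboolP //|h].
by apply/(eqmodP (coset_equiv N)); exact/asboolP.
Qed.

Lemma quotient_map_eq1 x : quotient_map x = 1 <-> (N : set G) x.
Proof. by rewrite -quotient_map1 quotient_mapP invg1 mulg1. Qed.

Lemma quotient_map_surj (c : quotient_group N) : exists x, quotient_map x = c.
Proof. by exists (repr c); exact: reprK. Qed.

End QuotientMap.

Section TorsionCosets.
Context {G : groupType}.
Implicit Types (K : set G) (ts : seq G).

(** Pigeonhole: among size ts + 1 powers of y, two share a coset. With K trivial it also shows that
    the elements of a finite subgroup have finite order. *)
Lemma power_mem_of_cover K ts y : is_subgroup K ->
  (forall i, exists2 t, t \in ts & K (t^-1 * y ^+ i)) -> exists k, K (y ^+ k.+1).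
Proof.
move=> sK tsP.
have /choice[r rP] : forall i, exists t, t \in ts /\ K (t^-1 * y ^+ i).
  by move=> i; have [t] := tsP i; exists t.
pose s := [seq r i | i <- iota 0 (size ts).+1].
have : ~~ uniq s.
  apply/negP => us; have : (size s <= size ts)%N.
    by apply: uniq_leq_size => // _ /mapP[i _ ->]; exact: (rP _).1.
  by rewrite size_map size_iota ltnn.
move=> /(uniqPn 1)[i [j [ij js]]].
rewrite size_map size_iota in js.
rewrite !(nth_map 0%N) ?size_iota ?(ltn_trans ij) // !nth_iota ?(ltn_trans ij) //.
rewrite !add0n => e; exists (j - i).-1; rewrite prednK ?subn_gt0 //.
have := is_subgroupM sK (is_subgroupV sK (rP i).2) (rP j).2.
rewrite e; have -> : y ^+ j = y ^+ i * y ^+ (j - i).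
  by rewrite -expgnDr subnKC // ltnW.
by rewrite !gnorm.
Qed.

(* With z in the last term L of the lower central series containing a power of
   y, all of yK acts on z as y does modulo the next term, i.e. trivially. *)
Lemma torsion_shift K n y : is_subgroup K -> is_normal K ->
  lower_central K n = [set 1] -> (exists k, K (y ^+ k.+1)) -> ~ finite_order y ->
  exists z, forall e d, K (y^-1 * e) -> finite_order e ->
    ~ finite_order (e * z ^+ d.+1).
Proof.
move=> sK nK Kn Ky ny; pose P i := exists k, lower_central K i (y ^+ k.+1).
have [i [[k Lz] nP]] : exists i, P i /\ ~ P i.+1.
  have : ~ P n by move=> [k]; rewrite Kn => yk; apply: ny; exists k.
  elim: (n) => [nP0|m IH nPm]; first by case: nP0.
  by have [Pm|/IH //] := pselect (P m); exists m.
have sL := lower_central_is_subgroup i sK.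
exists (y ^+ k.+1) => e d Ke [p ep] [q ewq].
pose N := NormalSubgroup (lower_central_is_subgroup i.+1 sK)
  (lower_central_normal (n := i.+1) nK).
set w := (y ^+ k.+1) ^+ d.+1 in ewq.
have Lw : lower_central K i w by exact: is_subgroupX.
pose f := quotient_map N.
have cwu : commute (f w) (f (y^-1 * e)).
  rewrite /commute /f -!quotient_mapM commgC quotient_mapM.
  have /quotient_map_eq1 -> : (N : set G) [~ w, y^-1 * e] by exact: lower_central_comm.
  by rewrite mulg1.
have cwy : commute (f w) (f y).
  rewrite /commute /f -!quotient_mapM; congr quotient_map.
  by apply/commute_sym/commuteX/commuteX.
have cwe : commute (f e) (f w).
  apply: commute_sym; have -> : f e = f y * f (y^-1 * e).
    by rewrite /f -quotient_mapM mulVKg.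
  exact: commuteM.
(* As the images of e and w commute, torsion of both e and e w forces a power of w, hence of y, into
   the next term, against the choice of i. *)
have : f (w ^+ (p.+1 * q.+1)) = 1.
  have : f ((e * w) ^+ (p.+1 * q.+1)) = 1.
    by rewrite mulnC expgnA ewq expg1n.
  rewrite /f (quotient_mapX N (e * w)) quotient_mapM expgMn // -!quotient_mapX.
  by rewrite expgnA ep expg1n quotient_map1 mul1g.
rewrite /w -!expgnA => /quotient_map_eq1; set m := (_ * _)%N.
have -> : m = m.-1.+1 by rewrite prednK // !muln_gt0.
by move=> ?; apply: nP; exists m.-1.
Qed.

(** * Densities of subsets in large balls *)

Section Densities.
Variables (S : set G) (K : set G) (ts : seq G).
Hypotheses (fgS : finite_generating S) (dS : doubling S) (sK : is_subgroup K).
Local Notation B n := (word_ball S n).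
Local Notation v n := (crd (word_ball S n)).

Let fB n : finite_set (B n).
Proof. exact: finite_word_ball fgS.1. Qed.

Lemma sparse_of_shift (E : set G) z :
  (forall e e' i j, E e -> E e' -> e * z ^+ i = e' * z ^+ j -> i = j) ->
  forall J, exists n0, forall n, (n0 <= n)%N ->
    (J * crd (B n `&` E) <= 2 * v n)%N.
Proof.
move=> Ez J; have [c Bz] := generated_word_ball z fgS.2.
(* The J translates fit in the ball of radius n + c J, eventually of size at most 2 v n: the source
   of the factor 2. *)
have [n0 H] := growth_ratio fgS.1 (c * J) dS 1; exists n0 => n hn.
have l : (v n <= v (n + c * J))%N by apply: growth_leq; [exact: fgS.1|exact: leq_addr].
apply: (@leq_trans (v (n + c * J))); last by have := H n hn; lia.
pose F (i : nat) := [set e * z ^+ i | e in B n `&` E].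
have fE : finite_set (B n `&` E) by exact: finite_setIl.
have fF i : finite_set (F i) by exact: finite_image.
have -> : (J * crd (B n `&` E) = \sum_(i <- iota 0 J) crd (F i))%N.
  rewrite (eq_bigr (fun=> crd (B n `&` E))) => [|i _].
    by rewrite big_const_seq count_predT iter_addn_0 size_iota mulnC.
  by apply: crd_image_inj => //; exact: mulIg.
rewrite -crd_bigcup_disj ?iota_uniq //.
  apply: crd_le => // x [i]; rewrite mem_iota add0n => iJ [e [Be _] <-].
  apply: word_ball_mul => //; apply: word_ball_leq (word_ball_exp i Bz).
  by rewrite leq_mul2l ltnW ?orbT.
by move=> i j a _ _ [e [_ Ee] <-] [e' [_ Ee'] /esym]; exact: Ez.
Qed.

Hypotheses (uts : uniq ts)
  (tsP : forall x, exists2 t, t \in ts & K (t^-1 * x))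
  (dts : forall t t', t \in ts -> t' \in ts -> K (t^-1 * t') -> t = t').

Local Notation coset t := [set x | K (t^-1 * x)].

Lemma crd_split_cosets (X : set G) : finite_set X ->
  crd X = (\sum_(t <- ts) crd (X `&` coset t))%N.
Proof.
move=> fX; rewrite -crd_bigcup_disj //.
- congr crd; apply/seteqP; split => x; last by case=> t _ [].
  by move=> Xx; have [t tts Kt] := tsP x; exists t.
- by move=> t _; exact: finite_setIl.
- move=> t t' x tts t'ts [_ Kt] [_ Kt']; apply: dts => //.
  have := is_subgroupM sK Kt (is_subgroupV sK Kt').
  by rewrite /= !gnorm.
Qed.

(** Left translation by t' t^-1 carries tK to t'K and lengthens elements by at most c. Summing over
    the cosets compares size ts copies of one coset part with the whole ball, in both directions,
    and the growth ratio absorbs c. *)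
Lemma coset_equidistributed J : exists n0, forall n, (n0 <= n)%N ->
  forall t, t \in ts ->
    (J * (size ts * crd (B n `&` coset t)) <= J.+1 * v n)%N /\
    (J * v n <= J.+1 * (size ts * crd (B n `&` coset t)))%N.
Proof.
have [c Hc] := generated_word_ball_seq [seq t * t'^-1 | t <- ts, t' <- ts] fgS.2.
have shift m t t' : t \in ts -> t' \in ts ->
    (crd (B m `&` coset t) <= crd (B (m + c) `&` coset t'))%N.
  move=> tts t'ts.
  rewrite -(crd_image_inj (@mulgI _ (t' * t^-1)) (finite_setIl _ (fB m))).
  apply: crd_le; first exact: finite_setIl.
  move=> _ [x [Bx Kx] <-]; split; last by rewrite /= !gnorm.
  rewrite addnC; apply: word_ball_mul => //; apply: Hc.
  by apply/allpairsP; exists (t', t).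
have const (a : nat) : (\sum_(t <- ts) a = size ts * a)%N.
  by rewrite big_const_seq count_predT iter_addn_0 mulnC.
have up m t : t \in ts -> (size ts * crd (B m `&` coset t) <= v (m + c))%N.
  move=> tts; rewrite (crd_split_cosets (fB (m + c))) -const.
  by rewrite !big_seq; apply: leq_sum => t' t'ts; exact: shift.
have low m t : t \in ts -> (v m <= size ts * crd (B (m + c) `&` coset t))%N.
  move=> tts; rewrite (crd_split_cosets (fB m)) -const.
  by rewrite !big_seq; apply: leq_sum => t' t'ts; exact: shift.
have [n0 H] := growth_ratio fgS.1 c dS J.
exists (n0 + c)%N => n hn t tts; split.
  apply: (@leq_trans (J * v (n + c))); first by rewrite leq_mul2l up ?orbT.
  have := H n (leq_trans (leq_addr _ _) hn); rewrite mulnBr mulSn; lia.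
apply: (@leq_trans (J.+1 * v (n - c))).
  have := H (n - c)%N; rewrite subnK; last by lia.
  move=> /(_ ltac:(lia)); rewrite mulnBr mulSn; lia.
rewrite leq_mul2l; apply/orP; right; have := low (n - c)%N t tts.
by rewrite subnK //; lia.
Qed.

End Densities.
End TorsionCosets.

Import numFieldNormedType.Exports.
Local Open Scope ring_scope.

(** * Existence of the torsion density *)

Section Limits.
Context {R : realType}.

Lemma cvg_of_bound (u : R^nat) (l : R) :
  (forall J : nat, exists n0, forall n, (n0 <= n)%N -> J%:R * `|u n - l| <= 2) ->
  u @ \oo --> l.
Proof.
move=> H; apply/cvgrPdist_le => e e0.
pose J := Num.bound (2 / e); have [n0 Hn] := H J.
have JE : 2 / e < J%:R by apply: archi_boundP; rewrite divr_ge0 // ltW.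
have J0 : 0 < J%:R :> R by apply: le_lt_trans JE; rewrite divr_ge0 // ltW.
exists n0 => // n /= /Hn; rewrite distrC => h.
rewrite -(ler_pM2l J0); apply: (le_trans h); rewrite ltr_pdivrMr // in JE.
exact: ltW.
Qed.

Lemma cvg_sum_seq (T : eqType) (s : seq T) (f : T -> R^nat) (a : T -> R) :
  (forall t, t \in s -> f t @ \oo --> a t) ->
  (fun n => \sum_(t <- s) f t n) @ \oo --> \sum_(t <- s) a t.
Proof.
elim: s => [|t s IH] fa.
  under eq_fun do rewrite big_nil; rewrite big_nil; exact: cvg_cst.
under eq_fun do rewrite big_cons; rewrite big_cons; apply: cvgD.
  by apply: fa; rewrite inE eqxx.
by apply: IH => u us; apply: fa; rewrite inE us orbT.
Qed.

End Limits.

Theorem virtually_nilpotent_torsion_density (R : realType) (G : groupType) :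
  virtually_nilpotent G -> exists l : R, has_torsion_density G l.
Proof.
move=> [H [sH [n Hn]] iH]; set K := normal_core H.
have sK : is_subgroup K by exact: normal_core_is_subgroup.
have nK : is_normal K by exact: normal_core_normal.
have Kn : lower_central K n = [set 1%g].
  apply/seteqP; split; last first.
    by move=> _ ->; exact: (lower_central_is_subgroup n sK).1.
  by rewrite -Hn; apply: lower_central_sub; exact: normal_core_sub.
have [s sP] := normal_core_cover sH iH.
have [ts [uts tsP dts]] := transversal_exists sK sP.
(* Rewriting words needs representatives of right cosets; as K is normal, conjugation by t^-1 turns
   tK into Kt. *)
have tsP' x : exists2 t, t \in ts & K (x * t^-1)%g.
  have [t tts Kt] := tsP x; exists t => //.
  by have := nK _ t^-1%g Kt; rewrite /conjg !gnorm.
pose cst t := [set x | K (t^-1 * x)%g].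
pose tors t := `[< cst t `<=` finite_order >].
exists (\sum_(t <- ts) (if tors t then (size ts)%:R^-1 else 0)) => S fgS.
have dS := virtually_nilpotent_doubling R fgS sK Kn tsP'.
have fB r : finite_set (word_ball S r) by exact: finite_word_ball fgS.1.
have fT r : finite_set (torsion_ball S r) by exact: finite_setIl.
have v0 r : 0 < (crd (word_ball S r))%:R :> R by rewrite ltr0n growth_gt0 //; exact: fgS.1.
have -> : torsion_ratio R S = fun r => \sum_(t <- ts)
    ((crd (torsion_ball S r `&` cst t))%:R / (crd (word_ball S r))%:R).
  apply/funext => r; rewrite /torsion_ratio -/(crd _) -/(crd _).
  by rewrite (crd_split_cosets sK uts tsP dts (fT r)) natr_sum mulr_suml.
apply: cvg_sum_seq => t tts; apply: cvg_of_bound => J.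
have m0 : (0 < size ts)%N by case: (ts) tts.
case: ifPn => [/asboolP tt|/asboolP ntt].
  have [n0 Hn0] := coset_equidistributed fgS dS sK uts tsP dts J.
  exists n0 => r /Hn0 /(_ t tts)[up low].
  have -> : torsion_ball S r `&` cst t = word_ball S r `&` cst t.
    by apply/seteqP; split => x [] => [[? _]|Bx] Cx; split => //; split => //; exact: tt.
  set a := crd (_ `&` _) in up low *; have := v0 r.
  have : (a <= crd (word_ball S r))%N by apply: crd_le => // x [].
  set v := crd _ in up low * => av v0r.
  have m0R : 0 < (size ts)%:R :> R by rewrite ltr0n.
  have m1R : 1 <= (size ts)%:R :> R by rewrite ler1n.
  have {}up : J%:R * ((size ts)%:R * a%:R) <= (J%:R + 1) * v%:R :> R.
    by rewrite natr1 -!natrM ler_nat.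
  have {}low : J%:R * v%:R <= (J%:R + 1) * ((size ts)%:R * a%:R) :> R.
    by rewrite natr1 -!natrM ler_nat.
  have {}av : a%:R <= v%:R :> R by rewrite ler_nat.
  rewrite -[J%:R]ger0_norm // -normrM ler_norml.
  have e : J%:R * (a%:R / v%:R - (size ts)%:R^-1) =
      (J%:R * ((size ts)%:R * a%:R) - J%:R * v%:R) / ((size ts)%:R * v%:R) :> R.
    by field; rewrite !gt_eqF.
  rewrite e ler_pdivlMr ?mulr_gt0 // ler_pdivrMr ?mulr_gt0 //.
  by apply/andP; split; nra.
have [x [Kx nx]] : exists x, K (t^-1 * x)%g /\ ~ finite_order x.
  apply: contrapT => h; apply: ntt => x Kx; apply: contrapT => nx.
  by apply: h; exists x.
have [z Hz] := torsion_shift sK nK Kn (power_mem_of_cover sK (fun i => tsP (x ^+ i)%g)) nx.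
pose E := [set e | K (x^-1 * e)%g /\ finite_order e].
have Ez e e' i j : E e -> E e' -> (e * z ^+ i = e' * z ^+ j)%g -> i = j.
  (* Cancelling the smaller power of z leaves the torsion element a equal to b times a positive
     power of z, which the choice of z excludes. *)
  suff lt a b c d : E a -> E b -> (c < d)%N -> (a * z ^+ c = b * z ^+ d)%g -> False.
    move=> Ee Ee' ee; have [ij|ji|//] := ltngtP i j.
      by case: (lt e e' i j).
    by case: (lt e' e j i).
  move=> [Ka ta] [Kb tb] cd ab; apply: (Hz b (d - c).-1 Kb tb).
  rewrite prednK ?subn_gt0 // expgnFr 1?ltnW // mulgA -ab mulgK.
  exact: ta.
have [n0 Hn0] := sparse_of_shift fgS dS Ez J.
exists n0 => r /Hn0 h; rewrite subr0 ger0_norm ?divr_ge0 //.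
rewrite mulrA ler_pdivrMr // -!natrM ler_nat; apply: leq_trans h.
rewrite leq_mul2l; apply/orP; right; apply: crd_le; first exact: finite_setIl.
move=> e [[Be te] Ke]; split => //; split => //.
have := is_subgroupM sK (is_subgroupV sK Kx) Ke.
by rewrite /= !gnorm.
Qed.

(** * Passing to the quotient by a finite normal subgroup *)

Section Quotient.
Variables (G : groupType) (Q : normal_subgroup G).
Hypothesis fQ : finite_set Q.
Local Open Scope group_scope.
Local Notation f := (quotient_map Q).

Let fiber (c : quotient_group Q) : set G := [set q * repr c | q in (Q : set G)].

Let fiberP c x : fiber c x <-> f x = c.
Proof.
have fr : f (repr c) = c by exact: reprK.
split=> [[q /quotient_map_eq1 Qq <-]|fx].
  by rewrite quotient_mapM fr Qq mul1g.
exists (x * (repr c)^-1); last by rewrite mulgVK.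
by apply/quotient_map_eq1; rewrite quotient_mapM quotient_mapV fr fx mulgV.
Qed.

Let preimageE (X : set (quotient_group Q)) : finite_set X ->
  f @^-1` X = [set x | exists2 c, c \in fset_set X & fiber c x].
Proof.
move=> fX; apply/seteqP; split => x.
  by move=> Xx; exists (f x); [rewrite in_fset_set // inE|exact/fiberP].
by move=> [c]; rewrite in_fset_set // inE => Xc /fiberP xc; rewrite /preimage /= xc.
Qed.

Lemma finite_quotient_preimage X : finite_set X -> finite_set (f @^-1` X).
Proof.
by move=> fX; rewrite preimageE //; apply: finite_bigcup_seq => c _; exact: finite_image.
Qed.

Lemma crd_quotient_preimage X : finite_set X ->
  crd (f @^-1` X) = (crd (Q : set G) * crd X)%N.
Proof.
move=> fX; rewrite preimageE // crd_bigcup_disj.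
- rewrite (eq_bigr (fun=> crd (Q : set G))) => [|c _].
    by rewrite big_const_seq count_predT iter_addn_0.
  by apply: crd_image_inj => //; exact: mulIg.
- exact: fset_uniq.
- by move=> c _; exact: finite_image.
- by move=> c d x _ _ /fiberP <- /fiberP.
Qed.

(** If the image is torsion, a power of x lies in the finite group Q and so has finite order. *)
Lemma finite_order_quotient x : finite_order (f x) <-> finite_order x.
Proof.
split=> [[n]|[n xn]]; last by exists n; rewrite -quotient_mapX xn.
rewrite -quotient_mapX => /quotient_map_eq1 Qx.
have s1 : is_subgroup [set 1 : G].
  by split=> // y z -> ->; rewrite mulgV.
have [i|k /= xk] := power_mem_of_cover (ts := fset_set (Q : set G)) (y := x ^+ n.+1) s1.
  exists (x ^+ n.+1 ^+ i); last by rewrite /= mulVg.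
  rewrite in_fset_set // inE.
  exact: is_subgroupX (normal_subgroup_is_subgroup Q) Qx.
by exists (n.+1 * k.+1).-1; rewrite prednK ?muln_gt0 // expgnA.
Qed.

(** Every element over 1 or over a letter of S is itself a letter, so an ambiguity in Q is absorbed
    by a single letter. At radius 0 the ball upstairs is trivial while the preimage is Q, hence
    [r.+1]. *)
Lemma word_ball_quotient (S : set (quotient_group Q)) r x :
  word_ball (f @^-1` S `|` Q) r.+1 x <-> word_ball S r.+1 (f x).
Proof.
set T := f @^-1` S `|` Q; split.
  have lift m y : word_ball T m y -> word_ball S m (f y).
    elim: m y => [|m IH] y.
      by move=> /word_ball0 ->; exact: word_ball1.
    move=> /word_ballS[->|[a [z [Ta /IH Sz ->]]]]; first exact: word_ball1.
    rewrite quotient_mapM -add1n; apply: word_ball_mul => //.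
    case: Ta => -[Sa|/quotient_map_eq1 Qa].
    - by apply: word_ball_letter; left.
    - by rewrite Qa; exact: word_ball1.
    - by apply: word_ball_letter; right; rewrite -quotient_mapV.
    - by rewrite -[f a]invgK -(quotient_mapV Q a) Qa invg1; exact: word_ball1.
  exact: lift.
have TQ y : (Q : set G) y -> word_ball T 1 y.
  by move=> Qy; apply: word_ball_letter; left; right.
have TS y : S (f y) \/ S (f y)^-1 -> word_ball T 1 y.
  move=> Sy; apply: word_ball_letter; case: Sy => Sy; [left|right]; left => //.
  by rewrite /= quotient_mapV.
elim: r x => [|r IH] x /word_ballS[/quotient_map_eq1 Qx|[b [c [Sb Bc e]]]].
- exact: TQ.
- by apply: TS; move: Bc e => /word_ball0 ->; rewrite mulg1 => ->.
- by apply: word_ball_leq (TQ _ Qx).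
have [y yc] := quotient_map_surj c; rewrite -yc in Bc e.
have -> : x = (x * y^-1) * y by rewrite mulgVK.
rewrite -add1n; apply: word_ball_mul; last exact: IH.
by apply: TS; rewrite quotient_mapM quotient_mapV e mulgK.
Qed.

Lemma finite_generating_quotient (S : set (quotient_group Q)) :
  finite_generating S -> finite_generating (f @^-1` S `|` Q).
Proof.
move=> [fS gS]; split.
  by rewrite finite_setU; split => //; exact: finite_quotient_preimage.
apply/seteqP; split => // x _.
have [r Br] := generated_word_ball (f x) gS.
have : word_ball (f @^-1` S `|` Q) r.+1 x.
  by apply/word_ball_quotient; apply: word_ball_leq Br.
by apply: word_ball_subgroup; [exact: generated_is_subgroup|exact: sub_generated].
Qed.

Lemma torsion_ratio_quotient (R : realType) (S : set (quotient_group Q)) r :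
  finite_set S ->
  torsion_ratio R (f @^-1` S `|` Q) r.+1 = torsion_ratio R S r.+1.
Proof.
move=> fS; rewrite /torsion_ratio -!/(crd _).
have fB : finite_set (word_ball S r.+1) by exact: finite_word_ball.
have -> : word_ball (f @^-1` S `|` Q) r.+1 = f @^-1` word_ball S r.+1.
  by apply/seteqP; split => x /word_ball_quotient.
have -> : torsion_ball (f @^-1` S `|` Q) r.+1 = f @^-1` torsion_ball S r.+1.
  apply/seteqP; split => x [/word_ball_quotient Bx /finite_order_quotient tx];
    by split.
rewrite !crd_quotient_preimage //; last exact: finite_setIl.
rewrite !natrM -mulf_div divff ?mul1r // pnatr_eq0 -lt0n.
exact: (crd_gt0 fQ (normal_subgroup_is_subgroup Q).1).
Qed.

End Quotient.

Theorem corollary10p1 (R : realType) (Gamma : groupType)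
    (Q : normal_subgroup Gamma) :
  finitely_generated Gamma ->
  virtually_nilpotent Gamma ->
  maximal_finite_normal Q ->
  exists2 l : R, has_torsion_density (quotient_group Q) l &
    forall S : set Gamma, finite_generating S ->
      torsion_ratio R S @ \oo --> l.
Proof.
move=> _ /(virtually_nilpotent_torsion_density R)[l dl] [fQ _].
(* The density found for [Gamma] is carried to the quotient: the ratios of [S] are compared with
   those of its lift to [Gamma]. *)
exists l => // S fgS; have := dl _ (finite_generating_quotient fQ fgS).
(* The two ratios are known to agree from radius 1 on, so both sequences are shifted by one. *)
rewrite -cvg_shiftS -[in X in _ -> X]cvg_shiftS.
by under eq_fun do rewrite (torsion_ratio_quotient fQ R _ fgS.1).
Qed.
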